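(* Let $d\ge 1$ and $k=d$. Suppose data are generated as follows: $Z\in\mathbb{R}^d$ is a random vector whose components $Z_1,\dots,Z_d$ are mutually independent, none of them is Gaussian, and each has finite second moment; $X=g(Z)$ where $g:\mathbb{R}^d\to\mathbb{R}^d$ is a bijection; and the label $Y$ is generated either (regression) as $Y=\Gamma Z+N_Y$, where $\Gamma\in\mathbb{R}^{k\times d}$ and $N_Y\in\mathbb{R}^k$ is a noise vector independent of $Z$ with $\mathbb{E}[N_Y]=0$, or (classification) as $Y\sim\mathsf{Bernoulli}(\sigma(\Gamma Z))$ applied elementwise, producing $Y\in\{0,1\}^k$, where $\sigma$ is the elementwise sigmoid. Consider predictors of the form $\Theta\circ\Phi$ with $\Theta\in\mathcal{H}_\Theta$ and $\Phi\in\mathcal{H}_\Phi$, where $\mathcal{H}_\Phi$ is a class of maps $\mathbb{R}^d\to\mathbb{R}^d$ with $g^{-1}\in\mathcal{H}_\Phi$, and $\mathcal{H}_\Theta$ is the set of all invertible $d\times d$ matrices, with $\Gamma\in\mathcal{H}_\Theta$. Let the risk be $R(\Theta\circ\Phi)=\mathbb{E}[\ell(Y,\Theta\circ\Phi(X))]$, where $\ell$ is the square loss $\|Y-\Theta\Phi(X)\|^2$ in the regression case and the (sum over tasks of the binary) cross-entropy loss with logits $\Theta\Phi(X)$ in the classification case. Let $\Theta^\dagger\circ\Phi^\dagger$ be any solution of the independence-constrained ERM problem $$\min_{\Theta\in\mathcal{H}_\Theta,\ \Phi\in\mathcal{H}_\Phi} R(\Theta\circ\Phi)\quad\text{subject to: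 the components of }\Phi(X)\text{ are mutually independent.}$$ Then $\Phi^\dagger$ identifies $Z$ up to permutation and scaling: there exist a permutation matrix $P$ and an invertible diagonal matrix $\Lambda$ such that $\Phi^\dagger(X)=P\Lambda Z$ almost surely.
   Context: A random vector $V=[V_1,\dots,V_d]$ has mutually independent components if for every subset $\mathcal{M}\subseteq\{1,\dots,d\}$ the joint distribution of $\{V_i\}_{i\in\mathcal{M}}$ equals the product of the marginal distributions. $\mathsf{Bernoulli}(q)$ denotes the Bernoulli distribution on $\{0,1\}$ with success probability $q$.
   Formalization: In the regression case the noise N_Y is also assumed to have finite second moments (otherwise every risk is infinite and every feasible pair is a solution), and constant components of Z count as (degenerate) Gaussian, hence are excluded. *)

(* Defs.v *)
From HB Require Import structures.
From mathcomp Require Import all_boot all_order all_algebra.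
From mathcomp Require Import all_classical all_reals all_analysis.
Set Implicit Arguments. Unset Strict Implicit. Unset Printing Implicit Defensive.
Import Order.TTheory GRing.Theory Num.Theory.
Local Open Scope classical_set_scope.
Local Open Scope ring_scope.

(* Vectors of R^n are n-tuples, with the product (Borel) sigma-algebra
   provided by MathComp-Analysis (generated by the coordinate maps). *)

Definition vcoord {T R : Type} {n : nat} (V : T -> n.-tuple R) (i : 'I_n) : T -> R :=
  fun w => tnth (V w) i.

Definition mxv {R : ringType} {n : nat} (A : 'M[R]_n) (v : n.-tuple R) : n.-tuple R :=
  [tuple \sum_(j < n) A i j * tnth v j | i < n].

Definition mutually_independent {d0 : measure_display} {T : measurableType d0}
  {R : realType} (P : probability T R) (n : nat) (V : T -> n.-tuple R) : Prop :=
  forall (M : {set 'I_n}) (B : 'I_n -> set R),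
    (forall i, measurable (B i)) ->
    P (\bigcap_(i in [set i | i \in M]) (vcoord V i @^-1` B i)) =
    (\prod_(i in M) P (vcoord V i @^-1` B i))%E.

Definition independent_vec {d0 : measure_display} {T : measurableType d0}
  {R : realType} (P : probability T R) (n m : nat)
  (U : T -> n.-tuple R) (W : T -> m.-tuple R) : Prop :=
  forall (A : set (n.-tuple R)) (B : set (m.-tuple R)),
    measurable A -> measurable B ->
    P (U @^-1` A `&` W @^-1` B) = (P (U @^-1` A) * P (W @^-1` B))%E.

(* a real random variable is Gaussian: its law is N(m, s^2) with s <> 0,
   or the degenerate Gaussian (Dirac mass at m, i.e. variance 0) *)
Definition is_gaussian {d0 : measure_display} {T : measurableType d0}
  {R : realType} (P : probability T R) (V : T -> R) : Prop :=
  exists (m s : R),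
    (s != 0 /\ forall A : set R, measurable A -> P (V @^-1` A) = normal_prob m s A)
    \/ (forall A : set R, measurable A -> P (V @^-1` A) = \d_m A).

Definition finite_second_moment {d0 : measure_display} {T : measurableType d0}
  {R : realType} (P : probability T R) (V : T -> R) : Prop :=
  P.-integrable setT (fun w => (V w ^+ 2)%:E).

Definition sigmoid {R : realType} (t : R) : R := (1 + expR (- t))^-1.

Inductive task := Regression | Classification.

Definition square_loss {R : realType} {n : nat} (y s : n.-tuple R) : R :=
  \sum_(i < n) (tnth y i - tnth s i) ^+ 2.

Definition cross_entropy_loss {R : realType} {n : nat} (y s : n.-tuple R) : R :=
  \sum_(i < n) (- tnth y i * ln (sigmoid (tnth s i))
                - (1 - tnth y i) * ln (1 - sigmoid (tnth s i))).

Definition loss {R : realType} {n : nat} (t : task) : n.-tuple R -> n.-tuple R -> R :=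
  match t with Regression => square_loss | Classification => cross_entropy_loss end.

Definition label_model {d0 : measure_display} {T : measurableType d0}
  {R : realType} (P : probability T R) (t : task) (d : nat) (Gamma : 'M[R]_d)
  (Z Y : T -> d.-tuple R) : Prop :=
  match t with
  | Regression =>
      exists N : T -> d.-tuple R,
        measurable_fun setT N /\ independent_vec P Z N /\
        (forall i, finite_second_moment P (vcoord N i)) /\
        (forall i, (\int[P]_w (vcoord N i w)%:E = 0)%E) /\
        (forall w i, tnth (Y w) i = tnth (mxv Gamma (Z w)) i + tnth (N w) i)
  | Classification =>
      (* Y_j in {0,1} and P(Y_j = 1 | Z) = sigmoid ((Gamma Z)_j) *)
      (forall w i, tnth (Y w) i = 0 \/ tnth (Y w) i = 1) /\
      forall (i : 'I_d) (A : set (d.-tuple R)), measurable A ->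
        P ([set w | tnth (Y w) i = 1] `&` Z @^-1` A) =
        (\int[P]_(w in Z @^-1` A) (sigmoid (tnth (mxv Gamma (Z w)) i))%:E)%E
  end.

Definition risk {d0 : measure_display} {T : measurableType d0}
  {R : realType} (P : probability T R) (t : task) (d : nat)
  (X Y : T -> d.-tuple R) (Theta : 'M[R]_d) (Phi : d.-tuple R -> d.-tuple R) : \bar R :=
  (\int[P]_w (loss t (Y w) (mxv Theta (Phi (X w))))%:E)%E.

(* Main.v *)
Require Import Defs.
From HB Require Import structures.
From mathcomp Require Import all_boot all_order all_algebra fingroup perm.
From mathcomp Require Import all_classical all_reals all_analysis.
From mathcomp Require Import measurable_realfun ring lra.
Set Implicit Arguments. Unset Strict Implicit. Unset Printing Implicit Defensive.
Import Order.TTheory GRing.Theory Num.Theory.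
Import numFieldNormedType.Exports.
Local Open Scope classical_set_scope.
Local Open Scope ring_scope.

(** Comparing the optimum with the pair (Gamma, g^-1), which is feasible, shows
    that the optimal scores are Gamma Z almost surely: by orthogonality of the
    noise in the regression case, by Gibbs' inequality in the classification
    case. Hence Phi(X) = A Z almost surely, with A invertible and both Z and A Z
    having independent components, and what remains is linear ICA.

    Characteristic functions are replaced by Gaussian smoothing. Second moments
    give A D A^T = D' with D, D' diagonal and positive, so that
    E prod_j exp(- (x_j - Z_j)^2 / (2 t^2 D_j)), which is a product of functions
    of the x_j, is also a product of functions of the (A x)_i. Taking logarithms
    and mixed second differences, if column j of A has two nonzero entries then
    ln E exp(- (x - Z_j)^2 / (2 s^2)) is quadratic in x for all s > 0. Thus Z_j
    convolved with N(0, s^2) is Gaussian; its moment generating function shows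
    that the mean is constant and the variance is v + s^2, and s -> 0 gives that
    Z_j is itself Gaussian, a contradiction. *)

(** The usual route must cope with the zeros of characteristic functions and ends with the theorems
    of Marcinkiewicz and Cramer. A Gaussian kernel avoids both: the smoothed functions are positive,
    so their logarithms exist on the whole line, and a second moment bounds these logarithms by a
    multiple of 1 + x^2. This bound excludes wild solutions of the difference equation without any
    smoothness. The quadratic form is available at every width s for the same Z_j, so comparing
    widths identifies the law. The covariance identity acts twice: it makes the kernel factor in
    both coordinate systems, and it gives A^-1 = D A^T D'^-1, so that two nonzero entries in column
    j of A are two nonzero entries in row j of A^-1, that is, two directions for the mixed
    difference that both move x_j. D is positive because a component of variance 0 counts as a
    degenerate Gaussian. *)

(** * Difference equations on the line *)

Section functional_equations.
Context {R : realType}.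
Implicit Types (f h : R -> R).

Lemma additive_natmul h : (forall x y, h (x + y) = h x + h y) ->
  forall n x, h (n%:R * x) = n%:R * h x.
Proof.
move=> hD; have h0 : h 0 = 0 by have := hD 0 0; rewrite addr0 => ?; lra.
elim=> [|n IH] x; first by rewrite !mul0r.
by rewrite -natr1 !mulrDl hD IH !mul1r.
Qed.

Lemma additive_locally_bounded_linear h (K : R) :
  (forall x y, h (x + y) = h x + h y) ->
  (forall x, `|x| <= 1 -> `|h x| <= K) -> forall x, h x = h 1 * x.
Proof.
move=> hD hK x.
(* By additivity, n |h x - h 1 x| stays bounded: reduce n x modulo 1. *)
have K0 : 0 <= K by apply: le_trans (hK 0 _); rewrite ?normr0.
have h0 : h 0 = 0 by have := hD 0 0; rewrite addr0 => ?; lra.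
have hN y : h (- y) = - h y by have := hD y (- y); rewrite subrr h0 => ?; lra.
pose u y := h y - h 1 * y.
have uD y z : u (y + z) = u y + u z by rewrite /u hD; ring.
have uZ (z : int) : u z%:~R = 0.
  have un n : u n%:R = 0.
    by rewrite /u -[n%:R]mulr1 additive_natmul// mulr1 mulrC subrr.
  case: z => n; first exact: un.
  rewrite NegzE mulrNz; have := uD (n.+1%:R) (- n.+1%:R).
  by rewrite subrr un add0r => <-; rewrite /u h0; ring.
have ub y : `|u y| <= K + K.
  have -> : u y = u (y - (Num.floor y)%:~R).
    by have := uD (y - (Num.floor y)%:~R) (Num.floor y)%:~R; rewrite subrK uZ addr0.
  have /andP[fy1 fy2] := floor_itv y.
  rewrite intrD in fy2.
  set z := y - _; have /andP[z0 z1] : (0 <= z) && (z <= 1).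
    by rewrite /z; apply/andP; split; lra.
  have zn : `|z| <= 1 by rewrite ger0_norm.
  rewrite /u (le_trans (ler_normB _ _))// lerD ?hK// normrM.
  by rewrite -[leRHS]mulr1 ler_pM// hK// normr1.
apply/eqP; rewrite -subr_eq0; apply/eqP; apply: contrapT => /eqP ux.
have uxp : 0 < `|u x| by rewrite normr_gt0.
pose n := (Num.truncn ((K + K) / `|u x|)).+1.
have : (K + K) / `|u x| < n%:R by exact: truncnS_gt.
rewrite ltr_pdivrMr// => hn.
have := ub (n%:R * x); rewrite (additive_natmul uD) normrM normr_nat.
by rewrite leNgt hn.
Qed.

(** The second difference [c] is symmetric and biadditive. The growth bound makes it locally
    bounded, hence c a b = k a b; removing k / 2 x^2 from [f] leaves an additive function, again
    locally bounded. *)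
Lemma constant_second_difference_quadratic f (c : R -> R -> R) (K : R) :
  (forall x a b, f (x + a + b) - f (x + a) - f (x + b) + f x = c a b) ->
  (forall x, `|f x| <= K * (1 + x ^+ 2)) ->
  exists p : R * R * R, forall x, f x = p.1.1 + p.1.2 * x + p.2 * x ^+ 2.
Proof.
move=> fc fK.
have cDl b x y : c (x + y) b = c x b + c y b.
  by rewrite -(fc 0 (x + y)) -(fc 0 x) -(fc x y) !add0r; ring.
have cC x y : c x y = c y x.
  by rewrite -(fc 0 x) -(fc 0 y) !add0r [x + y]addrC; ring.
have cE a b : c a b = f (a + b) - f a - f b + f 0 by rewrite -(fc 0) !add0r.
have K0 : 0 <= K by have := fK 0; rewrite expr0n addr0 mulr1; apply: le_trans.
have fl M x : `|x| <= M -> `|f x| <= K * (1 + M ^+ 2).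
  move=> xM; apply: le_trans (fK x) _; rewrite ler_wpM2l// lerD2l.
  by rewrite -real_normK ?num_real// lerXn2r// nnegrE// (le_trans _ xM).
have cl b : forall a, c a b = c 1 b * a.
  apply: (@additive_locally_bounded_linear _
    (K * (1 + (1 + `|b|) ^+ 2) + K * (1 + 1 ^+ 2) + K * (1 + `|b| ^+ 2)
      + K * (1 + 0 ^+ 2))).
    exact: cDl.
  move=> x x1; rewrite cE.
  apply: le_trans (ler_normD _ _) _; apply: lerD; last by apply: fl; rewrite normr0.
  apply: le_trans (ler_normB _ _) _; apply: lerD; last exact: fl.
  apply: le_trans (ler_normB _ _) _; apply: lerD; last exact: fl.
  by apply: fl; apply: le_trans (ler_normD _ _) _; rewrite lerD2r.
pose k := c 1 1.
have ck a b : c a b = k * a * b by rewrite cl cC cl /k; ring.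
pose h x := f x - f 0 - k / 2 * x ^+ 2.
have hD x y : h (x + y) = h x + h y.
  have := ck x y; rewrite cE => e; rewrite /h.
  have -> : f (x + y) = k * x * y + f x + f y - f 0 by lra.
  by field.
have hl : forall x, h x = h 1 * x.
  apply: (@additive_locally_bounded_linear _
    (K * (1 + 1 ^+ 2) + K * (1 + 0 ^+ 2) + `|k / 2|) hD) => x x1.
  apply: le_trans (ler_normB _ _) _; apply: lerD.
    apply: le_trans (ler_normB _ _) _; apply: lerD; first exact: fl.
    by apply: fl; rewrite normr0.
  rewrite normrM normrX -[leRHS]mulr1 ler_wpM2l//.
  by rewrite expr_le1.
exists (f 0, h 1, k / 2) => x /=.
by rewrite -hl /h; ring.
Qed.

(* Mixed second differences along the directions B e_i and B e_k annihilate the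
   right-hand side, which is separable in the coordinates A x. *)
Lemma separable_second_difference (n : nat) (A B : 'M[R]_n)
    (f g : 'I_n -> R -> R) (j i k : 'I_n) :
  A *m B = 1%:M ->
  (forall x : 'I_n -> R,
    \sum_l f l (x l) = \sum_m g m (\sum_l A m l * x l)) ->
  i != k -> B j i != 0 -> B j k != 0 ->
  exists c : R -> R -> R, forall x a b,
    f j (x + a + b) - f j (x + a) - f j (x + b) + f j x = c a b.
Proof.
move=> AB fg ik Bji Bjk.
pose D (h : R -> R) x a b := h (x + a + b) - h (x + a) - h (x + b) + h x.
(* The increments are scaled so that coordinate [j] moves by exactly [a] and [b]. The other
   coordinates start from 0, so their second differences do not see [x]. *)
exists (fun a b => - \sum_(l | l != j) D (f l) 0 (B l i * (a / B j i)) (B l k * (b / B j k))).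
move=> x a b.
pose p l : R := if l == j then x else 0.
pose u l := B l i * (a / B j i); pose v l := B l k * (b / B j k).
have ABE m q t : \sum_l A m l * (B l q * t) = (m == q)%:R * t.
  under eq_bigr do rewrite mulrA.
  rewrite -mulr_suml; congr (_ * _).
  by have /matrixP/(_ m q) := AB; rewrite !mxE.
have ADE m (y z : 'I_n -> R) :
    \sum_l A m l * (y l + z l) = \sum_l A m l * y l + \sum_l A m l * z l.
  by rewrite -big_split; apply: eq_bigr => l _; rewrite mulrDr.
have S0 : \sum_l D (f l) (p l) (u l) (v l) = 0.
  rewrite /D big_split/= !sumrB.
  rewrite (fg (fun l => p l + u l + v l)) (fg (fun l => p l + u l)).
  rewrite (fg (fun l => p l + v l)) (fg p) -!sumrB -big_split/=.
  apply: big1 => m _; rewrite !ADE !ABE.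
  case: (eqVneq m i) => [->|mi].
    by rewrite (negbTE ik) mul0r !addr0; ring.
  by rewrite mul0r !addr0; ring.
rewrite (bigD1 j)//= in S0.
have -> : \sum_(l | l != j) D (f l) 0 (B l i * (a / B j i)) (B l k * (b / B j k))
   = \sum_(l | l != j) D (f l) (p l) (u l) (v l).
  by apply: eq_bigr => l /negbTE lj; rewrite /p lj.
move/eqP: S0; rewrite addr_eq0 => /eqP <-.
by rewrite /D /p /u /v eqxx ![B j _ * (_ / _)]mulrC !divfK.
Qed.

End functional_equations.

(** * Transfer of integrals and almost sure equality *)

Lemma integral_probability_cst {d0 : measure_display} {T : measurableType d0}
    {R : realType} (P : probability T R) (r : R) : (\int[P]_w r%:E = r%:E)%E.
Proof.
have -> : (\int[P]_w r%:E = r%:E * P setT)%E by exact: integral_cst.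
by rewrite probability_setT mule1.
Qed.

Section transfer.
Context {d0 : measure_display} {T : measurableType d0} {R : realType}.
Context (mu : {measure set T -> \bar R}).
Context {d1 : measure_display} {S : measurableType d1}.
Import HBNNSimple.

Lemma integral_indic_preimage (V : T -> S) (B : set S) :
  measurable_fun setT V -> measurable B ->
  (\int[mu]_x (\1_B (V x))%:E = mu (V @^-1` B))%E.
Proof.
move=> mV mB; have mVB : measurable (V @^-1` B).
  by rewrite -[_ @^-1` _]setTI; exact: mV.
by rewrite -[V @^-1` B]setIT -integral_indic.
Qed.

Lemma integral_weight_preimage (w : T -> R) (V : T -> S) (r : R) (B : set S) :
  measurable_fun setT w -> (forall x, 0 <= w x) -> measurable_fun setT V ->
  measurable B -> 0 <= r ->
  (\int[mu]_x (w x * (r * \1_B (V x)))%:E =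
   r%:E * \int[mu]_(x in V @^-1` B) (w x)%:E)%E.
Proof.
move=> mw w0 mV mB r0.
have mVB : measurable (V @^-1` B) by rewrite -[_ @^-1` _]setTI; exact: mV.
rewrite -ge0_integralZl_EFin//.
- rewrite [RHS]integral_mkcond; apply: eq_integral => x _; rewrite patchE indicE.
  have -> : (x \in V @^-1` B) = (V x \in B) by apply/idP/idP; rewrite !inE.
  case: ifP => _; first by rewrite -EFinM mulr1 mulrC.
  by rewrite !mulr0.
- by move=> x _; rewrite lee_fin.
- by apply/measurable_EFinP; exact: measurable_funTS.
Qed.

(** Such weights have the same conditional expectation given [V]; the equality passes to simple
    functions by linearity and to [h] by monotone convergence. This replaces conditional
    expectations and product laws in the product rule, the orthogonality of the noise and the
    averaging of labels. *)
Lemma integral_weight_transfer (w1 w2 : T -> R) (V : T -> S) (h : S -> R) :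
  measurable_fun setT w1 -> measurable_fun setT w2 ->
  (forall x, 0 <= w1 x) -> (forall x, 0 <= w2 x) ->
  measurable_fun setT V -> measurable_fun setT h -> (forall y, 0 <= h y) ->
  (forall B, measurable B ->
     \int[mu]_(x in V @^-1` B) (w1 x)%:E = \int[mu]_(x in V @^-1` B) (w2 x)%:E)%E ->
  (\int[mu]_x (w1 x * h (V x))%:E = \int[mu]_x (w2 x * h (V x))%:E)%E.
Proof.
move=> mw1 mw2 w10 w20 mV mh h0 w12.
have mhE : measurable_fun setT (EFin \o h) by exact/measurable_EFinP.
pose g := nnsfun_approx measurableT mhE.
have simple (w : T -> R) (n : nat) : measurable_fun setT w -> (forall x, 0 <= w x) ->
    (\int[mu]_x (w x * g n (V x))%:E =
     \sum_(r \in range (g n)) r%:E *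
        \int[mu]_(x in V @^-1` (g n @^-1` [set r])) (w x)%:E)%E.
  move=> mw w0.
  transitivity (\int[mu]_x (\sum_(r \in range (g n))
      (w x * (r * \1_(g n @^-1` [set r]) (V x)))%:E)%E)%E.
    apply: eq_integral => x _; rewrite fsumEFin; last exact: fimfunP.
    rewrite [g n (V x)]fimfunE mulr_fsumr//.
  rewrite ge0_integral_fsum//.
  - apply: eq_fsbigr => r; rewrite inE => -[y _ <-].
    by apply: integral_weight_preimage.
  - move=> r; apply/measurable_EFinP; apply: measurable_funM => //.
    by apply: measurable_funM => //; exact: measurableT_comp.
  - move=> r x _; rewrite lee_fin; apply: mulr_ge0 => //.
    rewrite indicE; case: (boolP (_ \in _)); last by rewrite mulr0.
    by rewrite mulr1 inE /= => <-.
have lim (w : T -> R) : measurable_fun setT w -> (forall x, 0 <= w x) ->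
    ((fun n => \int[mu]_x (w x * g n (V x))%:E) @ \oo -->
      \int[mu]_x (w x * h (V x))%:E)%E.
  move=> mw w0.
  have -> : (\int[mu]_x (w x * h (V x))%:E =
      \int[mu]_x limn (fun n => (w x * g n (V x))%:E))%E.
    apply: eq_integral => x _; apply/esym/cvg_lim => //.
    have gh : (fun n => g n (V x)) @ \oo --> h (V x).
      have hE0 y : [set: S] y -> (0 <= (EFin \o h) y)%E by rewrite lee_fin.
      exact: (fine_cvg (cvg_nnsfun_approx measurableT mhE hE0 (x := V x) I)).
    by apply: cvg_EFin; [exact: nearW|apply: cvgM => //; exact: cvg_cst].
  apply: cvg_monotone_convergence => //.
  - move=> n; apply/measurable_EFinP; apply: measurable_funM => //.
    exact: measurableT_comp.
  - by move=> n x _; rewrite lee_fin mulr_ge0.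
  - move=> x _ a b ab; rewrite lee_fin ler_wpM2l//.
    exact/lefP/(nd_nnsfun_approx measurableT mhE).
apply: cvg_unique (lim _ mw1 w10) _ => //.
rewrite (_ : (fun n => _) = (fun n => \int[mu]_x (w2 x * g n (V x))%:E)%E).
  exact: lim.
apply/funext => n; rewrite !simple//.
by apply: eq_fsbigr => r _; rewrite w12.
Qed.
End transfer.

Section almost_everywhere.
Context {d0 : measure_display} {T : measurableType d0} {R : realType}.

Lemma ge0_integral_eq0_ae (mu : {measure set T -> \bar R}) (f : T -> R) :
  measurable_fun setT f -> (forall w, 0 <= f w) ->
  (\int[mu]_w (f w)%:E = 0)%E -> {ae mu, forall w, f w = 0}.
Proof.
move=> mf f0 If.
have : ae_eq mu setT (EFin \o f) (cst 0%E).
  apply/ae_eq_integral_abs => //; first exact/measurable_EFinP.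
  by rewrite -If; apply: eq_integral => w _; rewrite gee0_abs//= lee_fin.
by apply: filterS => w /(_ I)[].
Qed.

Lemma ae_eq_preimage (P : probability T R) {d1 : measure_display}
    {S : measurableType d1} (U V : T -> S) (B : set S) :
  measurable_fun setT U -> measurable_fun setT V -> measurable B ->
  {ae P, forall w, U w = V w} -> P (U @^-1` B) = P (V @^-1` B).
Proof.
move=> mU mV mB UV; rewrite -!integral_indic_preimage//.
apply: ae_eq_integral => //.
- by apply/measurable_EFinP/measurableT_comp => //; exact: measurable_indic.
- by apply/measurable_EFinP/measurableT_comp => //; exact: measurable_indic.
- by apply: filterS UV => w -> _.
Qed.

Lemma ae_eq_cst_dirac (P : probability T R) (X : T -> R) (m : R) :
  measurable_fun setT X -> {ae P, forall w, X w = m} ->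
  forall A, measurable A -> P (X @^-1` A) = \d_m A.
Proof.
move=> mX Xm A mA; rewrite (@ae_eq_preimage _ _ _ X (cst m))//.
rewrite diracE -integral_indic_preimage//=.
by rewrite -[RHS](integral_probability_cst P).
Qed.

End almost_everywhere.

(** * Gaussian integrals and quadratic exponentials *)

Section gaussian_integrals.
Context {R : realType}.
Notation mu := (@lebesgue_measure R).
Implicit Types (m s t x : R).

Lemma normal_pdf_peak m s x : s != 0 ->
  normal_pdf m s x = normal_peak s * normal_fun m s x.
Proof. by move=> s0; rewrite normal_pdfE. Qed.

(** Exponential tilting: completing the square gives the density of mean m + s^2 t times the
    constant on the right. *)
Lemma integral_normal_pdf_expR m s t : s != 0 ->
  (\int[mu]_x (expR (t * x) * normal_pdf m s x)%:E =
   (expR (t * m + s ^+ 2 * t ^+ 2 / 2))%:E)%E.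
Proof.
move=> s0.
transitivity (\int[mu]_x ((expR (t * m + s ^+ 2 * t ^+ 2 / 2))%:E *
    (normal_pdf (m + s ^+ 2 * t) s x)%:E))%E.
  apply: eq_integral => x _; rewrite -EFinM; congr EFin.
  rewrite !normal_pdf_peak// /normal_fun mulrCA [RHS]mulrCA; congr (_ * _).
  rewrite -!expRD; congr expR; rewrite -mulr_natr; field.
  by rewrite s0.
rewrite ge0_integralZl_EFin ?expR_ge0//.
- by rewrite integral_normal_pdf mule1.
- by move=> x _; rewrite lee_fin normal_pdf_ge0.
- by apply/measurable_EFinP; exact: measurable_normal_pdf.
Qed.

Lemma integral_expR_quadratic_lead_lt0 (a b c : R) :
  (\int[mu]_x (expR (a + b * x + c * x ^+ 2))%:E < +oo)%E -> c < 0.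
Proof.
rewrite ltNge => /negP oo; rewrite ltNge; apply/negP => c0; apply: oo.
have mE : measurable_fun setT (fun x => expR (a + b * x + c * x ^+ 2)).
  apply: measurableT_comp => //; apply: measurable_funD.
    by apply: measurable_funD => //; exact: measurable_funM.
  by apply: measurable_funM => //; exact: measurable_funX.
(* A half-line on which b x >= 0: if also c >= 0, the integrand is at least expR a there. *)
pose D : set R := [set` if 0 <= b then `[0, +oo[ else `]-oo, 0]].
have mD : measurable D by rewrite /D; case: ifP => _; exact: measurable_itv.
have muD : mu D = +oo%E by rewrite /D; case: ifP => _; rewrite lebesgue_measure_itv/= ?ltry ?ltNyr.
apply: (@le_trans _ _ (\int[mu]_(x in D) (expR a)%:E)%E).
  have -> : (\int[mu]_(x in D) (expR a)%:E = (expR a)%:E * mu D)%E.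
    exact: integral_cst.
  by rewrite muD gt0_muley// lte_fin expR_gt0.
apply: (@le_trans _ _ (\int[mu]_(x in D) (expR (a + b * x + c * x ^+ 2))%:E)%E).
  apply: ge0_le_integral => //.
    by apply/measurable_EFinP; exact: measurable_funTS.
  move=> x Dx; rewrite lee_fin ler_expR.
  have bx : 0 <= b * x.
    move: Dx; rewrite /D; case: ifPn => b0; rewrite /= in_itv/= ?andbT => x0.
      exact: mulr_ge0.
    by apply: mulr_le0 => //; rewrite ltW// ltNge.
  have := mulr_ge0 c0 (sqr_ge0 x); lra.
apply: ge0_subset_integral => //; first exact/measurable_EFinP.
Qed.

Lemma expR_quadratic_normal_pdf (a b c : R) : c < 0 ->
  exists m s k : R, 0 < s /\
    forall x, expR (a + b * x + c * x ^+ 2) = k * normal_pdf m s x.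
Proof.
move=> c0.
pose s := Num.sqrt (- (2 * c)^-1).
have s2 : s ^+ 2 = - (2 * c)^-1.
  by rewrite sqr_sqrtr// oppr_ge0 invr_le0; lra.
have s0 : 0 < s by rewrite sqrtr_gt0 oppr_gt0 invr_lt0; lra.
exists (- b / (2 * c)), s, (expR (a - b ^+ 2 / (4 * c)) / normal_peak s).
split => // x; rewrite normal_pdf_peak ?gt_eqF// [RHS]mulrA divfK; last first.
  by rewrite gt_eqF// normal_peak_gt0// gt_eqF.
rewrite /normal_fun -expRD; congr expR; rewrite s2 -mulr_natr; field.
by rewrite lt_eqF.
Qed.

End gaussian_integrals.

(** * Laws convolved with a Gaussian *)

Section smoothed_law.
Context {d0 : measure_display} {T : measurableType d0} {R : realType}.
Context (P : probability T R) (Z : T -> R).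
Hypothesis mZ : measurable_fun setT Z.
Notation mu := (@lebesgue_measure R).

Lemma measurable_normal_pdf_pair (s : R) : s != 0 ->
  measurable_fun setT (fun p : T * R => normal_pdf (Z p.1) s p.2).
Proof.
move=> s0.
have -> : (fun p : T * R => normal_pdf (Z p.1) s p.2) =
    normal_pdf 0 s \o (fun p => p.2 - Z p.1).
  by apply/funext => p /=; rewrite !normal_pdf_peak// /normal_fun subr0.
apply: measurableT_comp; first exact: measurable_normal_pdf.
by apply: measurable_funB => //; exact: measurableT_comp.
Qed.

(** Tonelli's theorem. The integral over [P] on the right is the density at [x] of [Z] plus an
    independent centred Gaussian of variance s^2; both sides are the expectation of [h] at that
    sum. *)
Lemma integral_smoothed (s : R) (h : R -> R) : s != 0 ->
  measurable_fun setT h -> (forall x, 0 <= h x) ->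
  (\int[P]_w \int[mu]_x (h x * normal_pdf (Z w) s x)%:E =
   \int[mu]_x ((h x)%:E * \int[P]_w (normal_pdf (Z w) s x)%:E))%E.
Proof.
move=> s0 mh h0.
have mf : measurable_fun setT (fun p : T * R => (h p.2 * normal_pdf (Z p.1) s p.2)%:E).
  apply/measurable_EFinP; apply: measurable_funM; last exact: measurable_normal_pdf_pair.
  exact: measurableT_comp.
have f0 p : (0 <= (h p.2 * normal_pdf (Z p.1) s p.2)%:E)%E.
  by rewrite lee_fin mulr_ge0// normal_pdf_ge0.
transitivity (\int[mu]_x \int[P]_w (h x * normal_pdf (Z w) s x)%:E)%E.
  exact: (@fubini_tonelli _ _ _ _ R P mu _ mf f0).
apply: eq_integral => x _.
under eq_integral do rewrite EFinM.
rewrite ge0_integralZl_EFin//.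
- by move=> w _; rewrite lee_fin normal_pdf_ge0.
- apply/measurable_EFinP.
  rewrite (_ : (fun w => _) =
    (fun p : T * R => normal_pdf (Z p.1) s p.2) \o (fun w => (w, x)))//.
  by apply: measurableT_comp; [exact: measurable_normal_pdf_pair|exact: measurable_fun_pair].
Qed.

(* Normalising the quadratic exponential: the mixture integrates to 1. *)
Lemma smoothed_quadratic_normal (s a b c : R) : s != 0 ->
  (forall x, \int[P]_w (normal_fun (Z w) s x)%:E =
     (expR (a + b * x + c * x ^+ 2))%:E)%E ->
  exists m s', 0 < s' /\
    forall x, (\int[P]_w (normal_pdf (Z w) s x)%:E = (normal_pdf m s' x)%:E)%E.
Proof.
move=> s0 Zq.
have pk : 0 < normal_peak s by exact: normal_peak_gt0.
have mZx x : measurable_fun setT (fun w => normal_fun (Z w) s x).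
  apply: measurableT_comp => //; apply: measurable_funM => //.
  apply: measurableT_comp => //; apply: measurable_funX.
  exact: measurable_funB.
have ZE x : (\int[P]_w (normal_pdf (Z w) s x)%:E =
    (normal_peak s)%:E * (expR (a + b * x + c * x ^+ 2))%:E)%E.
  rewrite -Zq; under eq_integral do rewrite normal_pdf_peak// EFinM.
  rewrite ge0_integralZl_EFin ?ltW//; last exact/measurable_EFinP.
  by move=> w _; rewrite lee_fin normal_fun_ge0.
have tot : (\int[mu]_x \int[P]_w (normal_pdf (Z w) s x)%:E = 1)%E.
  have := @integral_smoothed s (cst 1) s0 (measurable_cst _) (fun=> ler01).
  under eq_integral do under eq_integral do rewrite mul1r.
  under eq_integral do rewrite integral_normal_pdf.
  rewrite integral_probability_cst => ->.
  by apply: eq_integral => x _; rewrite mul1e.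
have mq : measurable_fun setT (fun x => expR (a + b * x + c * x ^+ 2)).
  apply: measurableT_comp => //; apply: measurable_funD.
    by apply: measurable_funD => //; exact: measurable_funM.
  by apply: measurable_funM => //; exact: measurable_funX.
have c0 : c < 0.
  apply: (@integral_expR_quadratic_lead_lt0 R a b).
  move: tot; under eq_integral do rewrite ZE.
  rewrite ge0_integralZl_EFin ?ltW//.
  - move=> e; rewrite ltNge leye_eq; apply/eqP => I.
    by move: e; rewrite I gt0_muley.
  - exact/measurable_EFinP.
have [m [s' [k [s'0 kE]]]] := expR_quadratic_normal_pdf a b c0.
exists m, s'; split => // x.
rewrite ZE kE -EFinM mulrA; congr EFin; rewrite -[RHS]mul1r; congr (_ * _).
have k0 : 0 <= k.
  rewrite leNgt; apply/negP => k0; have := expR_gt0 (a + b * m + c * m ^+ 2).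
  by rewrite kE ltNge => /negP; apply; rewrite nmulr_rle0// normal_pdf_ge0.
move: tot; under eq_integral do rewrite ZE kE -EFinM mulrA EFinM.
rewrite ge0_integralZl_EFin//.
- by rewrite integral_normal_pdf mule1 => -[].
- by move=> y _; rewrite lee_fin normal_pdf_ge0.
- by apply/measurable_EFinP; exact: measurable_normal_pdf.
- by rewrite mulr_ge0// ltW.
Qed.

(** Convolution multiplies moment generating functions, and the Gaussian factor expR (s^2 t^2 / 2)
    can be divided out. The sign of s'^2 - s^2 is still open here. *)
Lemma mgf_of_smoothed_normal (s m s' t : R) : s != 0 -> s' != 0 ->
  (forall x, \int[P]_w (normal_pdf (Z w) s x)%:E = (normal_pdf m s' x)%:E)%E ->
  (\int[P]_w (expR (t * Z w))%:E =
   (expR (t * m + (s' ^+ 2 - s ^+ 2) * t ^+ 2 / 2))%:E)%E.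
Proof.
move=> s0 s'0 Zn.
have me : measurable_fun setT (fun x : R => expR (t * x)).
  by apply: measurableT_comp => //; exact: measurable_funM.
have := integral_smoothed s0 me (fun x => expR_ge0 (t * x)).
under eq_integral do rewrite integral_normal_pdf_expR//.
under [in RHS]eq_integral do rewrite Zn -EFinM.
rewrite integral_normal_pdf_expR//.
under eq_integral do rewrite addrC expRD EFinM.
rewrite ge0_integralZl_EFin ?expR_ge0//; last first.
  by apply/measurable_EFinP; exact: (measurableT_comp me mZ).
set I := (X in (_ * X)%E); move=> e.
transitivity ((expR (- (s ^+ 2 * t ^+ 2 / 2)))%:E *
    ((expR (s ^+ 2 * t ^+ 2 / 2))%:E * I))%E.
  by rewrite muleA -EFinM -expRD addNr expR0 mul1e.
by rewrite e -EFinM -expRD; congr (expR _)%:E; field.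
Qed.

End smoothed_law.
Section smoothed_law_limit.
Context {d0 : measure_display} {T : measurableType d0} {R : realType}.
Context (P : probability T R) (Z : T -> R).
Hypothesis mZ : measurable_fun setT Z.
Notation mu := (@lebesgue_measure R).

(** A single width already determines the moment generating function of [Z], so the mean and the
    difference s'^2 - s^2 are the same for all widths; [v] is this difference read off at width
    1. *)
Lemma smoothed_normal_parameters :
  (forall s : R, 0 < s -> exists m s', 0 < s' /\
    forall x, (\int[P]_w (normal_pdf (Z w) s x)%:E = (normal_pdf m s' x)%:E)%E) ->
  exists m v : R, [/\ 0 <= v,
    (forall s : R, 0 < s -> forall x, (\int[P]_w (normal_pdf (Z w) s x)%:E =
       (normal_pdf m (Num.sqrt (v + s ^+ 2)) x)%:E)%E) &
    forall t, (\int[P]_w (expR (t * Z w))%:E = (expR (t * m + v * t ^+ 2 / 2))%:E)%E].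
Proof.
move=> Zn.
have [m [s1 [s10 E1]]] := Zn 1 ltr01.
have one0 : (1 : R) != 0 by [].
pose v := s1 ^+ 2 - 1 ^+ 2.
have mgf t : (\int[P]_w (expR (t * Z w))%:E = (expR (t * m + v * t ^+ 2 / 2))%:E)%E.
  by apply: mgf_of_smoothed_normal => //; rewrite gt_eqF.
have params s m' s' : 0 < s -> 0 < s' ->
    (forall x, (\int[P]_w (normal_pdf (Z w) s x)%:E = (normal_pdf m' s' x)%:E)%E) ->
    m' = m /\ s' ^+ 2 = v + s ^+ 2.
  move=> s0 s'0 E.
  have e t : t * m + v * t ^+ 2 / 2 = t * m' + (s' ^+ 2 - s ^+ 2) * t ^+ 2 / 2.
    apply: expR_inj; apply: EFin_inj; rewrite -mgf.
    by apply: mgf_of_smoothed_normal; rewrite ?gt_eqF.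
  (* The values at 1 and -1 separate the linear from the quadratic term. *)
  have := e 1; have := e (-1); rewrite sqrrN expr1n => ? ?.
  by split; lra.
exists m, v; split => //.
  (* A negative [v] would make the smoothed variance v + s^2 vanish at s = sqrt (- v), whereas [s']
     is positive. *)
  rewrite leNgt; apply/negP => v0.
  have r0 : 0 < Num.sqrt (- v) by rewrite sqrtr_gt0; lra.
  have [m' [s' [s'0 E]]] := Zn _ r0.
  have [_] := params _ _ _ r0 s'0 E.
  rewrite sqr_sqrtr ?subrr; last by lra.
  by move/eqP; rewrite sqrf_eq0 gt_eqF.
move=> s s0; have [m' [s' [s'0 E]]] := Zn _ s0.
have [<- <-] := params _ _ _ s0 s'0 E.
by rewrite sqrtr_sqr gtr0_norm.
Qed.

Lemma mgf_degenerate_dirac (m : R) (A : set R) :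
  (forall t, \int[P]_w (expR (t * Z w))%:E = (expR (t * m))%:E)%E ->
  measurable A -> P (Z @^-1` A) = \d_m A.
Proof.
move=> mgf mA.
have shifted t : (\int[P]_w (expR (t * (Z w - m)))%:E = 1)%E.
  under eq_integral do rewrite mulrBr addrC expRD EFinM.
  rewrite ge0_integralZl_EFin ?expR_ge0//; last first.
    by apply/measurable_EFinP/measurableT_comp => //; exact: measurable_funM.
  by rewrite mgf -EFinM -expRD addNr expR0.
(* [expR u + expR (- u) - 2] is nonnegative, and vanishes only at 0. *)
pose f w := expR (1 * (Z w - m)) + expR (-1 * (Z w - m)) - 2.
have fE w : f w = (expR (1 * (Z w - m)) - 1) ^+ 2 / expR (1 * (Z w - m)).
  have e0 : expR (1 * (Z w - m)) != 0 by rewrite gt_eqF// expR_gt0.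
  by rewrite /f mulN1r -{2}[Z w - m]mul1r expRN; field.
have f0 w : 0 <= f w by rewrite fE divr_ge0 ?sqr_ge0 ?expR_ge0.
have me t : measurable_fun setT (fun w => expR (t * (Z w - m))).
  by apply: measurableT_comp => //; apply: measurable_funM => //; exact: measurable_funB.
have mf : measurable_fun setT f.
  by apply: measurable_funB => //; apply: measurable_funD.
have If : (\int[P]_w (f w)%:E = 0)%E.
  have : (\int[P]_w ((f w)%:E + 2%:E) = 2%:E)%E.
    transitivity (\int[P]_w ((expR (1 * (Z w - m)))%:E + (expR (-1 * (Z w - m)))%:E))%E.
      by apply: eq_integral => w _; rewrite -!EFinD subrK.
    rewrite ge0_integralD// ?shifted; [by rewrite -EFinD|exact/measurable_EFinP|exact/measurable_EFinP].
  rewrite ge0_integralD//;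
    [|by move=> w _; rewrite lee_fin|exact/measurable_EFinP].
  rewrite integral_probability_cst; move: (\int[P]_w (f w)%:E)%E => [r||]//=.
  by rewrite -EFinD => -[r2]; congr EFin; lra.
apply: ae_eq_cst_dirac => //.
apply: filterS (ge0_integral_eq0_ae mf f0 If) => w /eqP.
rewrite fE mulf_eq0 invr_eq0 expR_eq0 orbF sqrf_eq0 subr_eq0.
by move=> /eqP; rewrite -[RHS]expR0 => /expR_inj; rewrite mul1r /= => ?; lra.
Qed.

End smoothed_law_limit.

(** * Gaussian tails and limits of Gaussian probabilities *)

Section gaussian_tails.
Context {R : realType}.
Notation mu := (@lebesgue_measure R).
Implicit Types (m s t z a x : R).

Lemma normal_prob_indic m s (A : set R) : measurable A ->
  (normal_prob m s A = \int[mu]_x (\1_A x * normal_pdf m s x)%:E)%E.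
Proof.
move=> mA; rewrite /normal_prob integral_mkcond; apply: eq_integral => x _.
by rewrite patchE indicE; case: ifP => _; rewrite ?mul1r ?mul0r.
Qed.

(** Chernoff's bound; the sign of [t] selects the upper or the lower tail at [a]. *)
Lemma normal_prob_le_expR z s t a (A : set R) : s != 0 -> measurable A ->
  (forall x, A x -> 0 <= t * (x - a)) ->
  (normal_prob z s A <= (expR (t * (z - a) + s ^+ 2 * t ^+ 2 / 2))%:E)%E.
Proof.
move=> s0 mA At.
have mt : measurable_fun setT (fun x => expR (t * x) * normal_pdf z s x).
  apply: measurable_funM; last exact: measurable_normal_pdf.
  by apply: measurableT_comp => //; exact: measurable_funM.
have -> : expR (t * (z - a) + s ^+ 2 * t ^+ 2 / 2) =
    expR (- (t * a)) * expR (t * z + s ^+ 2 * t ^+ 2 / 2).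
  by rewrite -expRD; congr expR; ring.
rewrite EFinM -(integral_normal_pdf_expR z t s0) -ge0_integralZl_EFin//.
- rewrite normal_prob_indic//; apply: ge0_le_integral => //.
  + by move=> x _; rewrite lee_fin mulr_ge0// normal_pdf_ge0.
  + apply/measurable_EFinP/measurable_funM; last exact: measurable_normal_pdf.
    exact: measurable_indic.
  + by apply/measurable_EFinP/measurable_funM.
  + move=> x _; rewrite -EFinM lee_fin mulrA -expRD.
    apply: ler_wpM2r; first exact: normal_pdf_ge0.
    rewrite indicE; case: (boolP (x \in A)) => [|_]; last exact: expR_ge0.
    rewrite inE => /At h; rewrite -expR0 ler_expR; lra.
- by move=> x _; rewrite lee_fin mulr_ge0// ?expR_ge0// normal_pdf_ge0.
- exact/measurable_EFinP.
Qed.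

(** At z = a the probability would stay at 1/2, which is why atoms of the law must be excluded later
    on. *)
Lemma normal_prob_cvg_indic z a : z != a ->
  (normal_prob z n.+1%:R^-1 `]-oo, a[%classic @[n --> \oo] -->
    (\1_(`]-oo, a[%classic : set R) z)%:E)%E.
Proof.
move=> za; set D := `]-oo, a[%classic : set R.
have mD : measurable D by exact: measurable_itv.
have s0 n : n.+1%:R^-1 != 0 :> R by rewrite invr_eq0 pnatr_eq0.
(* Chernoff's bound with t = n + 1 or - (n + 1) at standard deviation 1 / (n + 1): there s^2 t^2 =
   1, so the bound is expR (1/2 - (n + 1) y), a geometric sequence. *)
pose u (y : R) n := expR (2^-1 - y) * expR (- y) ^+ n.
have u0 y : 0 < y -> (u y n)%:E @[n --> \oo] --> 0%E.
  move=> y0; apply: cvg_EFin; first exact: nearW.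
  apply: cvg_geometric; rewrite ger0_norm ?expR_ge0//.
  by rewrite expR_lt1 oppr_lt0.
have uE y n (t : R) : t ^+ 2 = n.+1%:R ^+ 2 ->
    expR (- (n.+1%:R * y) + n.+1%:R^-1 ^+ 2 * t ^+ 2 / 2) = u y n.
  move=> ->; rewrite /u -expRM_natl -expRD; congr expR.
  by rewrite -natr1; field; rewrite natr1 pnatr_eq0.
case: (ltP z a) => [lt_za|]; last rewrite le_eqVlt eq_sym (negbTE za)/= => lt_az.
- rewrite indicE mem_set/=; last by rewrite /D /= in_itv.
  apply: (@squeeze_cvge _ _ _ _ (fun n => 1%:E - (u (a - z) n)%:E)%E _ (cst 1%E)).
  + apply: nearW => n; apply/andP; split; last exact: probability_le1.
    have -> : normal_prob z n.+1%:R^-1 D = (1 - normal_prob z n.+1%:R^-1 (~` D))%E.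
      by rewrite -probability_setC ?setCK//; exact: measurableC.
    apply: leeB => //.
    rewrite -(uE _ _ n.+1%:R)//.
    have -> : - (n.+1%:R * (a - z)) = n.+1%:R * (z - a) by ring.
    apply: (normal_prob_le_expR z (s0 n) (measurableC mD)) => x.
    rewrite /D /= in_itv/= => /negP; rewrite -leNgt => ax.
    by rewrite mulr_ge0// subr_ge0.
  + rewrite -[X in _ --> X](sube0 1%E); apply: cvgeB => //; first exact: cvg_cst.
    by apply: u0; rewrite subr_gt0.
  + exact: cvg_cst.
- rewrite indicE memNset/=; last by rewrite /D /= in_itv/= => /(lt_trans lt_az); rewrite ltxx.
  apply: (@squeeze_cvge _ _ _ _ (cst 0%E) _ (fun n => (u (z - a) n)%:E)).
  + apply: nearW => n; rewrite measure_ge0/=.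
    rewrite -(uE _ _ (- n.+1%:R) (sqrrN _)).
    have -> : - (n.+1%:R * (z - a)) = - n.+1%:R * (z - a) by ring.
    apply: (normal_prob_le_expR z (s0 n) mD) => x; rewrite /D /= in_itv/= => xa.
    by rewrite mulr_le0// ?oppr_le0// subr_le0 ltW.
  + exact: cvg_cst.
  + by apply: u0; rewrite subr_gt0.
Qed.

Lemma normal_peak_sqrt s : 0 <= s -> normal_peak s = s^-1 * (Num.sqrt (pi *+ 2))^-1.
Proof.
move=> s0; rewrite /normal_peak -mulrnAr sqrtrM ?sqr_ge0// sqrtr_sqr ger0_norm//.
by rewrite invfM.
Qed.

Lemma normal_pdf_sqrt_cvg m v x : 0 < v ->
  normal_pdf m (Num.sqrt (v + n.+1%:R^-1 ^+ 2)) x @[n --> \oo] -->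
    normal_pdf m (Num.sqrt v) x.
Proof.
move=> v0.
have n0 : n.+1%:R^-1 @[n --> \oo] --> (0 : R) by exact: cvg_harmonic.
have n2 : (v + n.+1%:R^-1 ^+ 2 : R) @[n --> \oo] --> v.
  rewrite -[X in _ --> X]addr0; apply: cvgD; first exact: cvg_cst.
  by rewrite -[X in _ --> X](mulr0 0); apply: cvgM.
have vn n : 0 < v + n.+1%:R^-1 ^+ 2 by rewrite ltr_pwDl// sqr_ge0.
have s0 u : 0 < u -> Num.sqrt u != 0 :> R by move=> u0; rewrite gt_eqF// sqrtr_gt0.
have pdfE u : 0 < u -> normal_pdf m (Num.sqrt u) x =
    (Num.sqrt u)^-1 * (Num.sqrt (pi *+ 2))^-1 * expR (- (x - m) ^+ 2 * (u * 2)^-1).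
  move=> u0; rewrite normal_pdf_peak ?s0// normal_peak_sqrt ?sqrtr_ge0//.
  by rewrite /normal_fun sqr_sqrtr ?ltW// mulr_natr.
rewrite pdfE//; under eq_fun do rewrite pdfE//.
apply: cvgM.
  apply: cvgM; last exact: cvg_cst.
  by apply: cvgV; [exact: s0|exact: (cvg_comp _ _ n2 (@sqrt_continuous R v))].
apply: (cvg_comp _ expR); last exact: continuous_expR.
apply: cvgM; first exact: cvg_cst.
apply: cvgV; first by rewrite mulf_neq0// gt_eqF.
by apply: cvgM => //; exact: cvg_cst.
Qed.

Lemma normal_prob_sqrt_cvg m v (A : set R) : 0 < v -> measurable A ->
  (normal_prob m (Num.sqrt (v + n.+1%:R^-1 ^+ 2)) A @[n --> \oo] -->
    normal_prob m (Num.sqrt v) A)%E.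
Proof.
move=> v0 mA.
have v10 : 0 < v + 1 by rewrite addr_gt0.
have s0 u : 0 < u -> Num.sqrt u != 0 :> R by move=> u0; rewrite gt_eqF// sqrtr_gt0.
(* The variances lie between v and v + 1, so the peak is at most that of variance v and the bell at
   most that of variance v + 1; [K] combines the two into one dominating function. *)
pose K := normal_peak (Num.sqrt v) / normal_peak (Num.sqrt (v + 1)).
have mpdf s : measurable_fun A (fun x => (normal_pdf m s x)%:E).
  by apply/measurable_EFinP/measurable_funTS; exact: measurable_normal_pdf.
have iK : mu.-integrable A (fun x => K%:E * (normal_pdf m (Num.sqrt (v + 1)) x)%:E)%E.
  apply: integrableZl => //; apply: (integrableS measurableT) => //.
  exact: integrable_normal_pdf.
pose f_ n x := (normal_pdf m (Num.sqrt (v + n.+1%:R^-1 ^+ 2)) x)%:E.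
have f_f : {ae mu, forall x, A x -> f_ n x @[n --> \oo] -->
    (normal_pdf m (Num.sqrt v) x)%:E}.
  apply: aeW => x _; apply: cvg_EFin; first exact: nearW.
  exact: normal_pdf_sqrt_cvg.
have f_g : {ae mu, forall x n, A x ->
    `|f_ n x| <= K%:E * (normal_pdf m (Num.sqrt (v + 1)) x)%:E}%E.
  apply: aeW => x n _; rewrite -EFinM lee_fin ger0_norm ?normal_pdf_ge0//.
  have vn : 0 < v + n.+1%:R^-1 ^+ 2 by rewrite ltr_pwDl// sqr_ge0.
  have n1 : n.+1%:R^-1 ^+ 2 <= 1 :> R.
    by rewrite expr_le1// ?invr_ge0// invf_le1// ler1n.
  rewrite !normal_pdf_peak ?s0// /K mulrA divfK ?gt_eqF ?normal_peak_gt0 ?s0//.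
  apply: ler_pM; rewrite ?normal_peak_ge0 ?normal_fun_ge0//.
    rewrite !normal_peak_sqrt ?sqrtr_ge0// ler_wpM2r ?invr_ge0 ?sqrtr_ge0//.
    by rewrite lef_pV2 ?posrE ?sqrtr_gt0// ler_wsqrtr// lerDl sqr_ge0.
  rewrite /normal_fun ler_expR !mulNr lerN2 (sqr_sqrtr (ltW vn)) (sqr_sqrtr (ltW v10)).
  rewrite ler_wpM2l ?sqr_ge0// lef_pV2 ?posrE ?pmulrn_lgt0//.
  by rewrite lerMn2r lerD2l n1 orbT.
have mf_ n : measurable_fun A (f_ n) by exact: mpdf.
by have [_ _] := @dominated_convergence _ _ R mu A mA f_ _ _ mf_ (mpdf _) f_f iK f_g.
Qed.

End gaussian_tails.

(** * Recovering the law as the smoothing width tends to 0 *)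

Section gaussian_law.
Context {d0 : measure_display} {T : measurableType d0} {R : realType}.
Context (P : probability T R) (Z : T -> R).
Hypothesis mZ : measurable_fun setT Z.
Notation mu := (@lebesgue_measure R).

Lemma measurable_normal_prob (s : R) (A : set R) : s != 0 -> measurable A ->
  measurable_fun setT (fun w => normal_prob (Z w) s A).
Proof.
move=> s0 mA.
pose f (p : T * R) := (\1_A p.2 * normal_pdf (Z p.1) s p.2)%:E.
have mf : measurable_fun setT f.
  apply/measurable_EFinP; apply: measurable_funM; last exact: measurable_normal_pdf_pair.
  by apply: measurableT_comp => //; exact: measurable_indic.
have f0 p : (0 <= f p)%E by rewrite lee_fin mulr_ge0// normal_pdf_ge0.
have -> : (fun w => normal_prob (Z w) s A) = @fubini_F _ _ T _ R mu f.
  by apply/funext => w; rewrite normal_prob_indic.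
exact: (@measurable_fun_fubini_tonelli_F _ _ T _ R mu f mf f0).
Qed.

Lemma integral_normal_prob (s m s' : R) (A : set R) : s != 0 -> measurable A ->
  (forall x, \int[P]_w (normal_pdf (Z w) s x)%:E = (normal_pdf m s' x)%:E)%E ->
  (\int[P]_w normal_prob (Z w) s A = normal_prob m s' A)%E.
Proof.
move=> s0 mA Zn; under eq_integral do rewrite normal_prob_indic//.
rewrite integral_smoothed//.
rewrite normal_prob_indic//; apply: eq_integral => x _.
by rewrite Zn -EFinM.
Qed.

(** An atom of mass p at [a] forces the smoothed density at [a] to be at least p times the peak of
    width s, which blows up as s tends to 0, while the Gaussian density stays below its peak at
    variance v. *)
Lemma smoothed_normal_atomless (m v a : R) : 0 < v ->
  (forall s : R, 0 < s -> forall x, (\int[P]_w (normal_pdf (Z w) s x)%:E =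
     (normal_pdf m (Num.sqrt (v + s ^+ 2)) x)%:E)%E) ->
  P (Z @^-1` [set a]) = 0%E.
Proof.
move=> v0 Zn.
have mZa : measurable (Z @^-1` [set a]).
  by rewrite -[_ @^-1` _]setTI; apply: mZ => //; exact: measurable_set1.
set p := P _; have pfin : p \is a fin_num by exact: fin_num_measure.
have sv : 0 < Num.sqrt v by rewrite sqrtr_gt0.
have bound s : 0 < s -> fine p * Num.sqrt v <= s.
  move=> s0.
  have vs : 0 < v + s ^+ 2 by rewrite ltr_pwDl// sqr_ge0.
  have ss : 0 < Num.sqrt (v + s ^+ 2) by rewrite sqrtr_gt0.
  have : (p * (normal_peak s)%:E <= (normal_peak (Num.sqrt v))%:E)%E.
    apply: (@le_trans _ _ (normal_pdf m (Num.sqrt (v + s ^+ 2)) a)%:E).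
      rewrite -Zn// /p -(integral_indic_preimage P mZ (measurable_set1 a)).
      rewrite -ge0_integralZr ?lee_fin ?normal_peak_ge0//; last first.
        by apply/measurable_EFinP/measurableT_comp => //; exact: measurable_indic.
      under eq_integral do rewrite -EFinM.
      apply: ge0_le_integral => //.
      + by move=> w _; rewrite lee_fin mulr_ge0// normal_peak_ge0.
      + apply/measurable_EFinP/measurable_funM => //.
        by apply: measurableT_comp => //; exact: measurable_indic.
      + apply/measurable_EFinP.
        rewrite (_ : (fun w => _) =
          (fun p : T * R => normal_pdf (Z p.1) s p.2) \o (fun w => (w, a)))//.
        apply: measurableT_comp; last exact: measurable_fun_pair.
        by apply: measurable_normal_pdf_pair => //; rewrite gt_eqF.
      + move=> w _; rewrite lee_fin indicE.
        case: (boolP (Z w \in _)) => [|_]; last by rewrite mul0r normal_pdf_ge0.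
        rewrite inE /= => ->; rewrite mul1r normal_pdf_peak ?gt_eqF//.
        by rewrite /normal_fun subrr expr0n/= oppr0 mul0r expR0 mulr1.
    rewrite lee_fin (le_trans (normal_pdf_ub _ _ _)) ?gt_eqF//.
    rewrite !normal_peak_sqrt ?sqrtr_ge0// ler_wpM2r ?invr_ge0 ?sqrtr_ge0//.
    by rewrite lef_pV2 ?posrE// ler_wsqrtr// lerDl sqr_ge0.
  rewrite -(fineK pfin) -EFinM lee_fin (normal_peak_sqrt (ltW s0)) (normal_peak_sqrt (ltW sv)) mulrA.
  have c0 : 0 < (Num.sqrt (pi *+ 2))^-1 :> R.
    by rewrite invr_gt0 sqrtr_gt0 mulrn_wgt0 ?pi_gt0.
  rewrite (ler_pM2r c0).
  by rewrite ler_pdivrMr// -ler_pdivlMr// mulrC.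
have p0 : 0 <= fine p by rewrite fine_ge0// measure_ge0.
rewrite -(fineK pfin); congr EFin; apply/eqP; rewrite eq_le p0 andbT leNgt.
apply/negP => pp; have h : 0 < fine p * Num.sqrt v by rewrite mulr_gt0.
(* The bound is contradicted at s = p sqrt v / 2. *)
by have := bound _ (divr_gt0 h (ltr0Sn R 1)); lra.
Qed.

(** On a half-line ending at [a], the smoothed probability tends to that of [Z] by dominated
    convergence, the exceptional event Z = a being null, and also to the Gaussian one of variance
    v. *)
Lemma smoothed_normal_law (m v : R) (A : set R) : 0 < v ->
  (forall s : R, 0 < s -> forall x, (\int[P]_w (normal_pdf (Z w) s x)%:E =
     (normal_pdf m (Num.sqrt (v + s ^+ 2)) x)%:E)%E) ->
  measurable A -> P (Z @^-1` A) = normal_prob m (Num.sqrt v) A.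
Proof.
move=> v0 Zn mA.
have s0 n : n.+1%:R^-1 != 0 :> R by rewrite invr_eq0 pnatr_eq0.
have cdf (a : R) : P (Z @^-1` `]-oo, a[%classic) =
    normal_prob m (Num.sqrt v) `]-oo, a[%classic.
  set D := `]-oo, a[%classic : set R.
  have mD : measurable D by exact: measurable_itv.
  suff lim : (normal_prob m (Num.sqrt (v + n.+1%:R^-1 ^+ 2)) D @[n --> \oo] -->
      P (Z @^-1` D))%E.
    apply: (cvg_unique _ lim) => //.
    exact: (@normal_prob_sqrt_cvg R m v D v0 mD).
  have -> : (fun n => normal_prob m (Num.sqrt (v + n.+1%:R^-1 ^+ 2)) D) =
      (fun n => \int[P]_w normal_prob (Z w) n.+1%:R^-1 D)%E.
    apply/funext => n; apply/esym/integral_normal_prob => // x.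
    by apply: Zn; rewrite invr_gt0.
  rewrite -(integral_indic_preimage P mZ mD).
  have mf n : measurable_fun setT (fun w => normal_prob (Z w) n.+1%:R^-1 D).
    exact: measurable_normal_prob.
  have mfl : measurable_fun setT (fun w => (\1_D (Z w) : R)%:E).
    by apply/measurable_EFinP/measurableT_comp => //; exact: measurable_indic.
  have f_f : {ae P, forall w, setT w ->
      normal_prob (Z w) n.+1%:R^-1 D @[n --> \oo] --> (\1_D (Z w) : R)%:E}.
    exists (Z @^-1` [set a]); split.
    - by rewrite -[_ @^-1` _]setTI; apply: mZ => //; exact: measurable_set1.
    - exact: smoothed_normal_atomless Zn.
    - move=> w /= h; apply: contrapT => /eqP za; apply: h => _.
      exact: normal_prob_cvg_indic.
  have f_g : {ae P, forall w n, setT w ->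
      `|normal_prob (Z w) n.+1%:R^-1 D| <= cst 1 w}%E.
    by apply: aeW => w n _; rewrite gee0_abs ?measure_ge0// probability_le1.
  have i1 : P.-integrable setT (cst 1%E) by exact: finite_measure_integrable_cst.
  by have [_ _] := dominated_convergence measurableT mf mfl f_f i1 f_g.
(* Agreement on half-lines suffices, since they are stable under intersection and generate the Borel
   sets; [Z'] is [Z] with values in the type for which this generation is stated. *)
pose Z' : T -> measurableTypeR R := Z.
have mZ' : measurable_fun setT Z' by exact: mZ.
pose mu2 : {measure set (measurableTypeR R) -> \bar R} := normal_prob m (Num.sqrt v).
apply: (@measure_unique _ R (measurableTypeR R) (@RGenInftyO.G R)
  (fun n => `]-oo, n%:R[%classic) _ _ _ _ (pushforward P Z') mu2) => //.
- exact: RGenInftyO.measurableE.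
- move=> _ _ [x ->] [y ->]; exists (Num.min x y).
  by apply/seteqP; split=> z /=; rewrite !in_itv/= lt_min => /andP.
- by move=> n; exists n%:R.
- rewrite -subTset => x _; exists (Num.truncn x).+1 => //=.
  by rewrite in_itv/= truncnS_gt.
- by move=> _ [a ->]; exact: cdf.
- move=> n; rewrite /pushforward; apply: le_lt_trans (ltry 1).
  by apply: probability_le1; rewrite -[_ @^-1` _]setTI; apply: mZ.
Qed.

Lemma smoothed_quadratic_gaussian :
  (forall s : R, 0 < s -> exists p : R * R * R, forall x,
    (\int[P]_w (normal_fun (Z w) s x)%:E =
     (expR (p.1.1 + p.1.2 * x + p.2 * x ^+ 2))%:E)%E) ->
  is_gaussian P Z.
Proof.
move=> Zq.
have [m [v [v0 Zn mgf]]] : exists m v : R, [/\ 0 <= v,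
    (forall s : R, 0 < s -> forall x, (\int[P]_w (normal_pdf (Z w) s x)%:E =
       (normal_pdf m (Num.sqrt (v + s ^+ 2)) x)%:E)%E) &
    forall t, (\int[P]_w (expR (t * Z w))%:E = (expR (t * m + v * t ^+ 2 / 2))%:E)%E].
  apply: smoothed_normal_parameters => // s s0; have [[[a b] c] E] := Zq s s0.
  by apply: smoothed_quadratic_normal E; rewrite ?gt_eqF.
exists m, (Num.sqrt v); move: v0; rewrite le_eqVlt => /predU1P[v0|v0].
- right=> A mA; apply: mgf_degenerate_dirac => // t.
  by rewrite mgf -v0 !mul0r addr0.
- left; split; first by rewrite gt_eqF// sqrtr_gt0.
  by move=> A mA; exact: smoothed_normal_law.
Qed.

End gaussian_law.

(** * Independence and integrals of products *)

Section independence.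
Context {d0 : measure_display} {T : measurableType d0} {R : realType}.
Context (P : probability T R).

Lemma integrable_dominated (f g : T -> R) : measurable_fun setT f ->
  (forall w, `|f w| <= g w) -> P.-integrable setT (fun w => (g w)%:E) ->
  P.-integrable setT (fun w => (f w)%:E).
Proof.
move=> mf fg; apply: le_integrable => //; first exact/measurable_EFinP.
by move=> w _; rewrite /= lee_fin (le_trans (fg w))// ler_norm.
Qed.

Lemma second_moment_integrable (X : T -> R) : measurable_fun setT X ->
  finite_second_moment P X -> P.-integrable setT (fun w => (X w)%:E).
Proof.
move=> mX X2; apply: (@integrable_dominated _ (fun w => 1 + X w ^+ 2)) => //.
  move=> w; rewrite -[X w ^+ 2]real_normK ?num_real//.
  by have := sqr_ge0 (`|X w| - 1); have := normr_ge0 (X w); nra.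
under [X in integrable _ _ X]eq_fun do rewrite EFinD.
apply: integrableD => //; exact: finite_measure_integrable_cst.
Qed.

Lemma second_moment_mul_integrable (X Y : T -> R) :
  measurable_fun setT X -> measurable_fun setT Y ->
  finite_second_moment P X -> finite_second_moment P Y ->
  P.-integrable setT (fun w => (X w * Y w)%:E).
Proof.
move=> mX mY X2 Y2.
apply: (@integrable_dominated _ (fun w => X w ^+ 2 + Y w ^+ 2)).
- exact: measurable_funM.
- move=> w; rewrite normrM -[X w ^+ 2]real_normK ?num_real//.
  rewrite -[Y w ^+ 2]real_normK ?num_real//.
  have := sqr_ge0 (`|X w| - `|Y w|).
  have := sqr_ge0 (`|X w|); have := sqr_ge0 (`|Y w|); nra.
- under [X in integrable _ _ X]eq_fun do rewrite EFinD.
  exact: integrableD.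
Qed.

Context {d1 : measure_display} {S : measurableType d1}.

(** By independence, the indicator of {V in B} and the constant P(V in B) have the same integral on
    every event of [N], so they may be exchanged against f(N). *)
Lemma indep_integral_indic (N : T -> R) (V : T -> S) (f : R -> R) (B : set S) :
  measurable_fun setT N -> measurable_fun setT V ->
  (forall (C : set R) (B : set S), measurable C -> measurable B ->
     P (N @^-1` C `&` V @^-1` B) = (P (N @^-1` C) * P (V @^-1` B))%E) ->
  measurable_fun setT f -> (forall x, 0 <= f x) -> measurable B ->
  (\int[P]_(w in V @^-1` B) (f (N w))%:E =
   P (V @^-1` B) * \int[P]_w (f (N w))%:E)%E.
Proof.
move=> mN mV ind mf f0 mB.
have mVB : measurable (V @^-1` B) by rewrite -[_ @^-1` _]setTI; exact: mV.
have pfin : P (V @^-1` B) \is a fin_num by exact: fin_num_measure.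
have p0 : 0 <= fine (P (V @^-1` B)) by rewrite fine_ge0// measure_ge0.
have mfN : measurable_fun setT (fun w => f (N w)) by exact: measurableT_comp.
transitivity (\int[P]_w (\1_B (V w) * f (N w))%:E)%E.
  rewrite integral_mkcond; apply: eq_integral => w _; rewrite patchE indicE.
  have -> : (w \in V @^-1` B) = (V w \in B) by apply/idP/idP; rewrite !inE.
  by case: ifP => _; rewrite ?mul1r ?mul0r.
rewrite -(fineK pfin) -ge0_integralZl_EFin//; last 2 first.
- by move=> w _; rewrite lee_fin.
- exact/measurable_EFinP.
transitivity (\int[P]_w (fine (P (V @^-1` B)) * f (N w))%:E)%E; last first.
  by apply: eq_integral => w _; rewrite EFinM.
apply: integral_weight_transfer => //.
  by apply: measurableT_comp => //; exact: measurable_indic.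
move=> C mC.
have mNC : measurable (N @^-1` C) by rewrite -[_ @^-1` _]setTI; exact: mN.
have -> : (\int[P]_(w in N @^-1` C) (fine (P (V @^-1` B)))%:E =
    (fine (P (V @^-1` B)))%:E * P (N @^-1` C))%E by exact: integral_cst.
by rewrite fineK// muleC -ind// setIC -integral_indic.
Qed.

(* With E N = 0, the positive and negative parts of N have the same integral on
   each event {V in B}, hence against each nonnegative function of V. *)
Lemma integral_indep_mean0 (N : T -> R) (V : T -> S) (h : S -> R) :
  measurable_fun setT N -> measurable_fun setT V -> measurable_fun setT h ->
  (forall (C : set R) (B : set S), measurable C -> measurable B ->
     P (N @^-1` C `&` V @^-1` B) = (P (N @^-1` C) * P (V @^-1` B))%E) ->
  finite_second_moment P N -> finite_second_moment P (h \o V) ->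
  (\int[P]_w (N w)%:E = 0)%E ->
  (\int[P]_w (N w * h (V w))%:E = 0)%E.
Proof.
move=> mN mV mh ind N2 h2 EN.
pose p (x : R) : R := Num.max x 0.
have p0 x : 0 <= p x by rewrite /p le_max lexx orbT.
have pn x : `|p x| <= `|x|.
  by rewrite /p; case: (leP x 0) => // _; rewrite normr0.
have pE x : x = p x - p (- x).
  by rewrite /p; case: (leP x 0) => h1; case: (leP (- x) 0) => h2'; lra.
have mp : measurable_fun setT p by apply: measurable_maxr.
have mpN : measurable_fun setT (fun x : R => p (- x)).
  by apply: measurableT_comp => //; exact: measurable_funN.
have iN := second_moment_integrable mN N2.
have iabs : P.-integrable setT (fun w => (`|N w|)%:E) by exact: integrable_abse iN.
have iNp : P.-integrable setT (fun w => (p (N w))%:E).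
  by apply: integrable_dominated iabs => //; exact: measurableT_comp.
have iNm : P.-integrable setT (fun w => (p (- N w))%:E).
  apply: integrable_dominated iabs; first exact: (measurableT_comp mpN mN).
  by move=> w; rewrite -[leRHS]normrN.
have Epm : (\int[P]_w (p (N w))%:E = \int[P]_w (p (- N w))%:E)%E.
  have fa := integrable_fin_num measurableT iNp.
  have fb := integrable_fin_num measurableT iNm.
  have : (\int[P]_w (p (N w))%:E - \int[P]_w (p (- N w))%:E = 0)%E.
    rewrite -integralB// -EN; apply: eq_integral => w _.
    by rewrite -EFinB -pE.
  by rewrite -(fineK fa) -(fineK fb) -EFinB => -[/subr0_eq ->].
have step (f : S -> R) : measurable_fun setT f -> (forall y, 0 <= f y) ->
    (\int[P]_w (p (N w) * f (V w))%:E = \int[P]_w (p (- N w) * f (V w))%:E)%E.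
  move=> mf f0; apply: integral_weight_transfer => //.
  - exact: measurableT_comp.
  - exact: (measurableT_comp mpN mN).
  move=> B mB; rewrite (indep_integral_indic mN mV ind mp p0 mB).
  by rewrite (indep_integral_indic mN mV ind mpN (fun x => p0 (- x)) mB) Epm.
have mhV : measurable_fun setT (fun w => h (V w)) by exact: measurableT_comp.
have iNh : P.-integrable setT (fun w => (`|N w * h (V w)|)%:E).
  exact: (integrable_abse (second_moment_mul_integrable mN mhV N2 h2)).
have i1 (q q' : R -> R) : measurable_fun setT q -> measurable_fun setT q' ->
    (forall x, `|q x| <= `|x|) -> (forall x, `|q' x| <= `|x|) ->
    P.-integrable setT (fun w => (q (N w) * q' (h (V w)))%:E).
  move=> mq mq' qn q'n; apply: integrable_dominated iNh.
    by apply: measurable_funM; exact: measurableT_comp.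
  by move=> w; rewrite !normrM ler_pM.
have pNn x : `|p (- x)| <= `|x| by rewrite -[leRHS]normrN.
(* Both factors are split into positive and negative parts. Each of the four products is dominated
   by |N h(V)|, so the integrals may be separated and cancel in pairs. *)
transitivity (\int[P]_w (((p (N w) * p (h (V w)))%:E - (p (- N w) * p (h (V w)))%:E)
   - ((p (N w) * p (- h (V w)))%:E - (p (- N w) * p (- h (V w)))%:E)))%E.
  apply: eq_integral => w _; rewrite -!EFinB; congr EFin.
  by rewrite {1}(pE (N w)) {1}(pE (h (V w))); ring.
have ia := i1 p p mp mp pn pn.
have ib := i1 (fun x => p (- x)) p mpN mp pNn pn.
have ic := i1 p (fun x => p (- x)) mp mpN pn pNn.
have id := i1 (fun x => p (- x)) (fun x => p (- x)) mpN mpN pNn pNn.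
rewrite integralB//; [|exact: integrableB|exact: integrableB].
rewrite !integralB//.
rewrite (step (fun y => p (h y)))//; last exact: measurableT_comp.
rewrite (step (fun y => p (- h y)))//; last exact: (measurableT_comp mpN mh).
by rewrite !subee ?integrable_fin_num// sube0.
Qed.

End independence.
Section independent_vectors.
Context {d0 : measure_display} {T : measurableType d0} {R : realType}.
Context (P : probability T R) (n : nat) (V : T -> n.-tuple R).
Hypotheses (mV : measurable_fun setT V) (indV : mutually_independent P V).

Lemma measurable_vcoord j : measurable_fun setT (vcoord V j).
Proof. exact: (measurableT_comp (measurable_tnth j) mV). Qed.

Lemma measurable_vcoord_preimage j (B : set R) : measurable B ->
  measurable (vcoord V j @^-1` B).
Proof. by move=> mB; rewrite -[_ @^-1` _]setTI; exact: measurable_vcoord. Qed.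

Lemma mutually_independent_pair i k (C B : set R) : i != k ->
  measurable C -> measurable B ->
  P (vcoord V i @^-1` C `&` vcoord V k @^-1` B) =
  (P (vcoord V i @^-1` C) * P (vcoord V k @^-1` B))%E.
Proof.
move=> ik mC mB.
have := @indV [set i; k]%SET (fun j => if j == i then C else B).
rewrite big_setU1 ?inE//= big_set1 eqxx eq_sym (negbTE ik) => <-.
  congr (P _); apply/seteqP; split=> w /=.
    move=> [wi wk] j /=; rewrite !inE => /orP[/eqP ->|/eqP ->]; rewrite ?eqxx//.
    by rewrite eq_sym (negbTE ik).
  move=> h; split; first by have := h i; rewrite /= !inE eqxx; apply.
  by have := h k; rewrite /= !inE eqxx orbT eq_sym (negbTE ik); apply.
by move=> j; case: ifP.
Qed.

Lemma integral_prod_unit_interval (f : T -> R) :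
  measurable_fun setT f -> (forall w, 0 <= f w <= 1) ->
  (\int[P]_w (f w)%:E)%E \is a fin_num.
Proof.
move=> mf f01; apply: integrable_fin_num => //.
apply: (@integrable_dominated _ _ _ P f (fun=> 1)) => //.
  by move=> w; have /andP[f0 f1] := f01 w; rewrite ger0_norm.
exact: finite_measure_integrable_cst.
Qed.

(* Starting from products of indicators, the coordinates are turned one by one
   into arbitrary functions by the transfer lemma. *)
Lemma mutually_independent_integral_prod (h : 'I_n -> R -> R) :
  (forall j, measurable_fun setT (h j)) -> (forall j x, 0 <= h j x <= 1) ->
  (\int[P]_w (\prod_j h j (vcoord V j w))%:E =
   (\prod_j fine (\int[P]_w (h j (vcoord V j w))%:E))%:E)%E.
Proof.
suff main (s : seq 'I_n) : forall h : 'I_n -> R -> R,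
    (forall j, measurable_fun setT (h j)) -> (forall j x, 0 <= h j x <= 1) ->
    (forall j, j \notin s -> exists2 B, measurable B & h j = \1_B) ->
  (\int[P]_w (\prod_j h j (vcoord V j w))%:E =
   (\prod_j fine (\int[P]_w (h j (vcoord V j w))%:E))%:E)%E.
  by move=> mh h01; apply: (main (enum 'I_n)) => // j; rewrite mem_enum.
elim: s => {h} [|j0 s IH] h mh h01 hs.
  have /choice[B mB] : forall j, exists B, measurable B /\ h j = \1_B.
    by move=> j; have [//|B mB hB] := hs j; exists B.
  have hB j := (mB j).2; have {}mB j := (mB j).1.
  have hP j : (\int[P]_w (h j (vcoord V j w))%:E = P (vcoord V j @^-1` B j))%E.
    by rewrite hB; exact: (integral_indic_preimage P (measurable_vcoord j) (mB j)).
  under [in RHS]eq_bigr do rewrite hP.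
  have := @indV [set: 'I_n]%SET B mB.
  set E := \bigcap_(i in _) _.
  have mE : measurable E.
    by apply: fin_bigcap_measurable => [|i _]; [exact: finite_finset|exact: measurable_vcoord_preimage].
  have -> : (\prod_(i in [set: 'I_n]%SET) P (vcoord V i @^-1` B i) =
      (\prod_i fine (P (vcoord V i @^-1` B i)))%:E)%E.
    rewrite -prodEFin; apply: eq_big => [i|i _]; first by rewrite inE.
    by rewrite fineK// fin_num_measure//; exact: measurable_vcoord_preimage.
  move=> <-; rewrite -[E]setIT -integral_indic//.
  apply: eq_integral => w _; congr EFin; rewrite indicE.
  case: (boolP (w \in E)) => wE.
    apply: big1 => j _; rewrite hB indicE mem_set//.
    by move/set_mem : wE => /(_ j); apply; rewrite /= inE.
  apply/eqP; rewrite prodf_seq_eq0; apply: contraNT wE => /hasPn wE.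
  apply/mem_set => j _ /=; have := wE j (mem_index_enum j).
  by rewrite /= hB indicE pnatr_eq0 eqb0 negbK => /set_mem.
pose W w := \prod_(j | j != j0) h j (vcoord V j w).
pose c := \prod_(j | j != j0) fine (\int[P]_w (h j (vcoord V j w))%:E).
have mhV j : measurable_fun setT (fun w => h j (vcoord V j w)).
  by apply: measurableT_comp => //; exact: measurable_vcoord.
have h0 j x : 0 <= h j x by have /andP[] := h01 j x.
have mW : measurable_fun setT W.
  rewrite (_ : W = fun w => \prod_(j <- index_enum 'I_n) if j != j0 then h j (vcoord V j w) else 1).
    apply: (@measurable_prod _ _ _ _ _ _
      (fun j w => if j != j0 then h j (vcoord V j w) else 1)) => j _.
    by case: (j != j0).
  by apply/funext => w; rewrite /W big_mkcond.
have W0 w : 0 <= W w by apply: prodr_ge0.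
have c0 : 0 <= c.
  by apply: prodr_ge0 => j _; rewrite fine_ge0// integral_ge0// => w _; rewrite lee_fin.
have transfer : (\int[P]_w (W w * h j0 (vcoord V j0 w))%:E =
    \int[P]_w (c * h j0 (vcoord V j0 w))%:E)%E.
  apply: integral_weight_transfer => //; first exact: measurable_vcoord.
  (* With an indicator at [j0] the induction hypothesis applies; it says that the random weight [W]
     and the constant [c] agree on every event of coordinate [j0]. *)
  move=> C mC; pose hC j := if j == j0 then \1_C else h j.
  have := IH hC; have -> : (\int[P]_(w in vcoord V j0 @^-1` C) c%:E =
      c%:E * P (vcoord V j0 @^-1` C))%E.
    by apply: integral_cst; exact: measurable_vcoord_preimage.
  rewrite (bigD1 j0)//= /hC eqxx integral_indic_preimage//; last exact: measurable_vcoord.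
  rewrite (eq_bigr (fun j => fine (\int[P]_w (h j (vcoord V j w))%:E))); last first.
    by move=> j /negbTE ->.
  rewrite EFinM fineK ?fin_num_measure//; last exact: measurable_vcoord_preimage.
  rewrite muleC => <-.
  - rewrite integral_mkcond; apply: eq_integral => w _; rewrite patchE.
    rewrite (bigD1 j0)//= eqxx (eq_bigr (fun j => h j (vcoord V j w))); last first.
      by move=> j /negbTE ->.
    rewrite indicE; have -> : (w \in vcoord V j0 @^-1` C) = (vcoord V j0 w \in C).
      by apply/idP/idP; rewrite !inE.
    by case: ifP => _; rewrite ?mul1r ?mul0r.
  - by move=> j; case: ifP => // _; exact: measurable_indic.
  - move=> j x; case: ifP => // _.
    by rewrite indicE; case: (x \in C); rewrite ?lexx ?ler01.
  - move=> j js; case: eqVneq => [_|jj0]; first by exists C.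
    by apply: hs; rewrite inE negb_or jj0.
rewrite (bigD1 j0)//= -/c.
transitivity (\int[P]_w (W w * h j0 (vcoord V j0 w))%:E)%E.
  by apply: eq_integral => w _; rewrite (bigD1 j0)//= mulrC.
rewrite transfer mulrC EFinM fineK; last exact: integral_prod_unit_interval.
under eq_integral do rewrite EFinM.
rewrite ge0_integralZl_EFin//; last exact/measurable_EFinP.
by move=> w _; rewrite lee_fin.
Qed.

End independent_vectors.

(** * Second moments and covariances *)

Section second_moments.
Context {d0 : measure_display} {T : measurableType d0} {R : realType}.
Context (P : probability T R).

Lemma integral_sum_fin (I : finType) (f : I -> T -> R) :
  (forall i, P.-integrable setT (fun w => (f i w)%:E)) ->
  (\int[P]_w (\sum_i f i w)%:E = (\sum_i fine (\int[P]_w (f i w)%:E))%:E)%E.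
Proof.
move=> fi; under eq_integral do rewrite -sumEFin.
rewrite integral_sum// -sumEFin; apply: eq_bigr => i _.
by rewrite fineK// integrable_fin_num.
Qed.

Lemma integrable_sum_fin (I : finType) (f : I -> T -> R) :
  (forall i, P.-integrable setT (fun w => (f i w)%:E)) ->
  P.-integrable setT (fun w => (\sum_i f i w)%:E).
Proof.
move=> fi; under [X in integrable _ _ X]eq_fun do rewrite -sumEFin.
exact: integrable_sum.
Qed.

Lemma integrable_scale (a : R) (f : T -> R) :
  P.-integrable setT (fun w => (f w)%:E) ->
  P.-integrable setT (fun w => (a * f w)%:E).
Proof.
move=> fi; under [X in integrable _ _ X]eq_fun do rewrite EFinM.
exact: integrableZl.
Qed.

Lemma fine_integral_scale (a : R) (f : T -> R) :
  P.-integrable setT (fun w => (f w)%:E) ->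
  fine (\int[P]_w (a * f w)%:E)%E = a * fine (\int[P]_w (f w)%:E)%E.
Proof.
move=> fi; under eq_integral do rewrite EFinM.
rewrite integralZl// fineM//; exact: integrable_fin_num.
Qed.

Definition centered (X : T -> R) : T -> R :=
  fun w => X w - fine (\int[P]_w (X w)%:E)%E.

Lemma measurable_centered (X : T -> R) :
  measurable_fun setT X -> measurable_fun setT (centered X).
Proof. by move=> mX; exact: measurable_funB. Qed.

Lemma second_moment_shift (X : T -> R) (c : R) : measurable_fun setT X ->
  finite_second_moment P X -> finite_second_moment P (fun w => X w - c).
Proof.
move=> mX X2; apply: (@integrable_dominated _ _ _ P _ (fun w => 2 * X w ^+ 2 + 2 * c ^+ 2)).
- by apply: measurable_funX; exact: measurable_funB.
- move=> w; rewrite ger0_norm ?sqr_ge0//.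
  have := sqr_ge0 (X w + c); rewrite !expr2; nra.
- under [X in integrable _ _ X]eq_fun do rewrite EFinD.
  apply: integrableD => //; first exact: integrable_scale.
  exact: finite_measure_integrable_cst.
Qed.

Lemma integral_centered (X : T -> R) : measurable_fun setT X ->
  finite_second_moment P X -> (\int[P]_w (centered X w)%:E = 0)%E.
Proof.
move=> mX X2; have iX := second_moment_integrable mX X2.
under eq_integral do rewrite /centered EFinB.
rewrite integralB//; last exact: finite_measure_integrable_cst.
by rewrite integral_probability_cst fineK ?integrable_fin_num// subee// integrable_fin_num.
Qed.

(** Zero variance makes [X] almost surely constant, hence of Dirac law, which [is_gaussian]
    includes. *)
Lemma not_gaussian_variance_gt0 (X : T -> R) : measurable_fun setT X ->
  finite_second_moment P X -> ~ is_gaussian P X ->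
  0 < fine (\int[P]_w (centered X w * centered X w)%:E)%E.
Proof.
move=> mX X2 ngX; have mc := measurable_centered mX.
have c2 : finite_second_moment P (centered X) by exact: second_moment_shift.
have ci := second_moment_mul_integrable mc mc c2 c2.
have c0 w : 0 <= centered X w * centered X w by rewrite -expr2 sqr_ge0.
rewrite lt_def fine_ge0 ?integral_ge0// ?andbT; last by move=> w _; rewrite lee_fin.
apply/eqP => v0; apply: ngX.
exists (fine (\int[P]_w (X w)%:E)%E), 0; right.
apply: ae_eq_cst_dirac => //.
have : {ae P, forall w, centered X w * centered X w = 0}.
  apply: ge0_integral_eq0_ae => //; first exact: measurable_funM.
  by rewrite -[LHS]fineK ?integrable_fin_num// v0.
apply: filterS => w /eqP; rewrite mulf_eq0 orbb => /eqP.
by rewrite /centered => /subr0_eq.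
Qed.

End second_moments.

Section linear_mixtures.
Context {d0 : measure_display} {T : measurableType d0} {R : realType}.
Context (P : probability T R) (n : nat) (Z : T -> n.-tuple R).
Hypotheses (mZ : measurable_fun setT Z) (indZ : mutually_independent P Z).
Hypothesis Z2 : forall j, finite_second_moment P (vcoord Z j).

Lemma mutually_independent_uncorrelated i k : i != k ->
  (\int[P]_w (centered P (vcoord Z i) w * centered P (vcoord Z k) w)%:E = 0)%E.
Proof.
move=> ik; pose c := fine (\int[P]_w (vcoord Z k w)%:E)%E.
have mi := measurable_vcoord mZ i; have mk := measurable_vcoord mZ k.
pose shift (a : R) := fun x : R => x - a.
have ms a : measurable_fun setT (shift a) by exact: measurable_funB.
apply: (@integral_indep_mean0 _ _ _ P _ _ (centered P (vcoord Z i)) (vcoord Z k) (shift c)) => //.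
- exact: measurable_centered.
- move=> C B mC mB.
  have -> : centered P (vcoord Z i) @^-1` C =
      vcoord Z i @^-1` (shift (fine (\int[P]_w (vcoord Z i w)%:E)%E) @^-1` C) by [].
  apply: mutually_independent_pair => //.
  by rewrite -[_ @^-1` _]setTI; exact: ms.
- exact: second_moment_shift.
- exact: second_moment_shift.
- exact: integral_centered.
Qed.

Context (A : 'M[R]_n).
Let W w := mxv A (Z w).

Lemma vcoord_mxv i w : vcoord W i w = \sum_j A i j * vcoord Z j w.
Proof. by rewrite /vcoord /W /mxv tnth_mktuple. Qed.

Lemma measurable_mxv : measurable_fun setT W.
Proof.
apply/measurable_fun_tnthP => i.
rewrite (_ : _ \o _ = fun w => \sum_j A i j * vcoord Z j w); last first.
  by apply/funext => w; rewrite -vcoord_mxv.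
apply: measurable_sum => j; apply: measurable_funM => //.
exact: measurable_vcoord.
Qed.

Lemma mxv_second_moment i : finite_second_moment P (vcoord W i).
Proof.
rewrite /finite_second_moment.
rewrite (_ : (fun w => _) = fun w => (\sum_(p : 'I_n * 'I_n)
    A i p.1 * A i p.2 * (vcoord Z p.1 w * vcoord Z p.2 w))%:E).
  apply: integrable_sum_fin => p; apply: integrable_scale.
  by apply: second_moment_mul_integrable => //; exact: measurable_vcoord.
apply/funext => w; rewrite vcoord_mxv expr2 big_distrlr/= pair_bigA/=.
by congr EFin; apply: eq_bigr => p _; ring.
Qed.

Lemma centered_mxv i w :
  centered P (vcoord W i) w = \sum_j A i j * centered P (vcoord Z j) w.
Proof.
have iZ j : P.-integrable setT (fun w => (vcoord Z j w)%:E).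
  by apply: second_moment_integrable => //; exact: measurable_vcoord.
rewrite /centered vcoord_mxv; under eq_integral do rewrite vcoord_mxv.
rewrite integral_sum_fin/=; last by move=> j; exact: integrable_scale.
rewrite -sumrB; apply: eq_bigr => j _.
by rewrite fine_integral_scale// mulrBr.
Qed.

Let s j := fine (\int[P]_w (centered P (vcoord Z j) w * centered P (vcoord Z j) w)%:E)%E.

Lemma covariance_mxv i k :
  (\int[P]_w (centered P (vcoord W i) w * centered P (vcoord W k) w)%:E =
   (\sum_j A i j * s j * A k j)%:E)%E.
Proof.
have iZ j l : P.-integrable setT
    (fun w => (centered P (vcoord Z j) w * centered P (vcoord Z l) w)%:E).
  apply: second_moment_mul_integrable; try exact: measurable_centered (measurable_vcoord mZ _).
    by apply: second_moment_shift => //; exact: measurable_vcoord.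
  by apply: second_moment_shift => //; exact: measurable_vcoord.
transitivity (\int[P]_w (\sum_(p : 'I_n * 'I_n) A i p.1 * A k p.2 *
    (centered P (vcoord Z p.1) w * centered P (vcoord Z p.2) w))%:E)%E.
  apply: eq_integral => w _; rewrite !centered_mxv big_distrlr/= pair_bigA/=.
  by congr EFin; apply: eq_bigr => p _; ring.
rewrite integral_sum_fin; last by move=> p; exact: integrable_scale.
congr EFin; rewrite -(pair_bigA _ (fun j l => fine (\int[P]_w (A i j * A k l *
  (centered P (vcoord Z j) w * centered P (vcoord Z l) w))%:E)%E))/=.
apply: eq_bigr => j _; rewrite (bigD1 j)//= fine_integral_scale// big1 ?addr0.
  by rewrite /s; ring.
move=> l lj; rewrite fine_integral_scale// mutually_independent_uncorrelated ?mulr0//.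
by rewrite eq_sym.
Qed.

End linear_mixtures.

(** * Matrices orthogonal for diagonal weights *)

Section weighted_orthogonality.
Context {R : realFieldType} (n : nat) (A : 'M[R]_n) (s s' : 'I_n -> R).
Hypotheses (s0 : forall j, s j != 0) (s'0 : forall i, s' i != 0).
Hypothesis AsA : forall i k, \sum_j A i j * s j * A k j = (i == k)%:R * s' i.

(** This is D A^T D'^-1 with D = diag s and D' = diag s', the inverse of [A] when A D A^T = D'. The
    explicit form shows that its zeros are those of A^T. *)
Definition weighted_adjoint : 'M[R]_n := \matrix_(j, i) (s j * A i j / s' i).

Lemma mulmx_weighted_adjoint : A *m weighted_adjoint = 1%:M.
Proof.
apply/matrixP => i k; rewrite !mxE.
under eq_bigr do rewrite mxE !mulrA.
rewrite -mulr_suml AsA; case: eqVneq => [->|_]; last by rewrite !mul0r.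
by rewrite mul1r divff.
Qed.

Lemma weighted_adjoint_entry_sum j l :
  \sum_i s j * A i j / s' i * A i l = (j == l)%:R.
Proof.
have /matrixP/(_ j l) := mulmx1C mulmx_weighted_adjoint.
by rewrite !mxE => <-; apply: eq_bigr => i _; rewrite mxE.
Qed.

(** [A] is an isometry from the norm of D^-1 to that of D'^-1, since A^T D'^-1 A = D^-1. These norms
    are the exponents of the two smoothing kernels. *)
Lemma weighted_quadratic_form (u : 'I_n -> R) :
  \sum_i (\sum_j A i j * u j) ^+ 2 / s' i = \sum_j u j ^+ 2 / s j.
Proof.
transitivity (\sum_j \sum_l u j * u l / s j * \sum_i s j * A i j / s' i * A i l).
  transitivity (\sum_i \sum_j \sum_l u j * u l / s j * (s j * A i j / s' i * A i l)).
    apply: eq_bigr => i _; rewrite expr2 big_distrlr/= mulr_suml.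
    apply: eq_bigr => j _; rewrite mulr_suml; apply: eq_bigr => l _.
    by field; rewrite s0 s'0.
  rewrite exchange_big/=; apply: eq_bigr => j _.
  rewrite exchange_big/=; apply: eq_bigr => l _.
  by rewrite mulr_sumr.
apply: eq_bigr => j _; rewrite (bigD1 j)//= weighted_adjoint_entry_sum eqxx.
rewrite big1 ?addr0 ?mulr1 ?expr2// => l lj.
by rewrite weighted_adjoint_entry_sum eq_sym (negbTE lj) mulr0.
Qed.

(** The weighted square sum of a column is 1, so it has a nonzero entry, and only one by hypothesis.
    Distinct columns are orthogonal for the weights 1 / s', so these entries lie in distinct rows
    and their positions define a permutation. *)
Lemma single_support_monomial :
  (forall i k j, A i j != 0 -> A k j != 0 -> i = k) ->
  exists Pm Lambda : 'M[R]_n,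
    [/\ is_perm_mx Pm, is_diag_mx Lambda, Lambda \in unitmx & A = Pm *m Lambda].
Proof.
move=> single.
have /choice[f fA] : forall j, exists i, A i j != 0.
  move=> j; apply: contrapT => /forallNP A0.
  have := weighted_adjoint_entry_sum j j; rewrite eqxx big1 => [/esym/eqP|i _].
    by rewrite oner_eq0.
  have /negP := A0 i; rewrite negbK => /eqP ->; exact: mulr0.
have A0 i j : i != f j -> A i j = 0.
  by move=> ij; apply/eqP; apply: contraNT ij => Aij; rewrite (single _ _ _ Aij (fA j)).
have f_inj : injective f.
  move=> j l fjl; apply/eqP; rewrite -[_ == _]negbK; apply/negP => jl.
  have := weighted_adjoint_entry_sum j l; rewrite (negbTE jl) (bigD1 (f j))//= big1.
    move/eqP; rewrite addr0 !mulf_eq0 invr_eq0 (negbTE (s0 _)) (negbTE (s'0 _)).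
    by rewrite (negbTE (fA j)) fjl (negbTE (fA l)).
  by move=> i ij; rewrite (A0 _ _ ij) mulr0 !mul0r.
(* [perm_mx p] has its ones at (i, p i), whereas the nonzero entries of [A] sit at (f j, j); hence
   the inverse. *)
pose p := (perm f_inj)^-1%g.
pose L := \row_j A (f j) j.
exists (perm_mx p), (diag_mx L); split.
- exact: perm_mx_is_perm.
- exact: diag_mx_is_diag.
- rewrite unitmxE det_diag unitfE; apply/prodf_neq0 => j _; by rewrite mxE.
- apply/matrixP => i j; rewrite mul_mx_diag !mxE.
  have -> : (p i == j) = (i == f j).
    by rewrite -(inj_eq (@perm_inj _ (perm f_inj))) permKV permE.
  case: eqVneq => [->|ij]; first by rewrite mul1r.
  by rewrite mul0r A0.
Qed.

End weighted_orthogonality.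

(** * Growth of the logarithm of a smoothed law *)

Section smoothed_logarithm.
Context {d0 : measure_display} {T : measurableType d0} {R : realType}.
Context (P : probability T R).

Lemma normal_fun_unit_interval (m s x : R) : 0 <= normal_fun m s x <= 1.
Proof.
rewrite normal_fun_ge0/= -expR0 ler_expR mulNr oppr_le0.
by rewrite divr_ge0 ?sqr_ge0// mulrn_wge0// sqr_ge0.
Qed.

Lemma measurable_normal_fun_mean (s x : R) :
  measurable_fun setT (fun m : R => normal_fun m s x).
Proof.
apply: measurableT_comp => //; apply: measurable_funM => //.
apply: measurableT_comp => //; apply: measurable_funX.
exact: measurable_funB.
Qed.

Lemma smoothed_fin_num (X : T -> R) (s x : R) : measurable_fun setT X ->
  (\int[P]_w (normal_fun (X w) s x)%:E)%E \is a fin_num.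
Proof.
move=> mX; apply: integral_prod_unit_interval.
  exact: (measurableT_comp (measurable_normal_fun_mean s x)).
by move=> w; exact: normal_fun_unit_interval.
Qed.

(* Jensen's inequality, in the form of a tangent line to the exponential. *)
Lemma smoothed_ge_expR (X : T -> R) (s x : R) : 0 < s ->
  measurable_fun setT X -> finite_second_moment P X ->
  expR (- (x ^+ 2 + fine (\int[P]_w (X w ^+ 2)%:E)%E) / s ^+ 2) <=
  fine (\int[P]_w (normal_fun (X w) s x)%:E)%E.
Proof.
move=> s0 mX X2; set q := fine (\int[P]_w (X w ^+ 2)%:E)%E.
set y := - (x ^+ 2 + q) / s ^+ 2.
have qE : (\int[P]_w (X w ^+ 2)%:E = q%:E)%E by rewrite /q fineK// integrable_fin_num.
have s2 : 0 < s ^+ 2 by rewrite exprn_gt0.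
pose b := expR y / s ^+ 2.
have ib : P.-integrable setT (fun w => (b * X w ^+ 2)%:E) by exact: integrable_scale.
have ia : P.-integrable setT (fun=> (expR y + b * q)%:E).
  exact: finite_measure_integrable_cst.
rewrite -lee_fin fineK ?smoothed_fin_num//.
apply: (@le_trans _ _ (\int[P]_w ((expR y + b * q)%:E - (b * X w ^+ 2)%:E))%E).
  rewrite integralB// integral_probability_cst.
  under [X in (_ - X)%E]eq_integral do rewrite EFinM.
  by rewrite integralZl// qE -EFinM -EFinB addrK.
apply: le_integral => //.
- exact: integrableB.
- apply: (@integrable_dominated _ _ _ P _ (fun=> 1)).
  + exact: (measurableT_comp (measurable_normal_fun_mean s x)).
  + by move=> w; have /andP[? ?] := normal_fun_unit_interval (X w) s x; rewrite ger0_norm.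
  + exact: finite_measure_integrable_cst.
move=> w _; rewrite -EFinB lee_fin.
(* By (x - X)^2 <= 2 (x^2 + X^2), [z] bounds the kernel's exponent from below; [y] is the mean of
   [z], and the tangent is taken at [y]. *)
pose z := - (x ^+ 2 + X w ^+ 2) / s ^+ 2.
have zy : expR y * (1 + (z - y)) <= expR z.
  have -> : expR z = expR y * expR (z - y) by rewrite -expRD addrC subrK.
  by rewrite ler_wpM2l ?expR_ge0// expR_ge1Dx.
apply: (@le_trans _ _ (expR y * (1 + (z - y)))).
  have -> : z - y = (q - X w ^+ 2) / s ^+ 2 by rewrite /z /y; ring.
  by rewrite le_eqVlt; apply/orP; left; apply/eqP; rewrite /b; ring.
apply: le_trans zy _; rewrite /normal_fun ler_expR /z.
have -> : - (x - X w) ^+ 2 / (s ^+ 2 *+ 2) = - (x - X w) ^+ 2 / 2 / s ^+ 2.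
  by rewrite -mulr_natr; field; rewrite gt_eqF.
rewrite ler_pM2r ?invr_gt0//.
have := sqr_ge0 (x + X w); rewrite !expr2; nra.
Qed.

(** The kernel is at most 1, so the logarithm is at most 0; from below, the Jensen bound is
    quadratic in [x]. *)
Lemma ln_smoothed_bound (X : T -> R) (s : R) : 0 < s ->
  measurable_fun setT X -> finite_second_moment P X ->
  exists K, forall x,
    `|ln (fine (\int[P]_w (normal_fun (X w) s x)%:E)%E)| <= K * (1 + x ^+ 2).
Proof.
move=> s0 mX X2; pose q := fine (\int[P]_w (X w ^+ 2)%:E)%E.
have q0 : 0 <= q.
  by rewrite fine_ge0// integral_ge0// => w _; rewrite lee_fin sqr_ge0.
have s2 : 0 < s ^+ 2 by rewrite exprn_gt0.
exists ((1 + q) / s ^+ 2) => x.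
have := smoothed_ge_expR x s0 mX X2; rewrite -/q.
set F := fine _ => Fy; have F0 : 0 < F by exact: lt_le_trans (expR_gt0 _) Fy.
have F1 : F <= 1.
  rewrite -lee_fin fineK ?smoothed_fin_num// -(integral_probability_cst P 1).
  apply: ge0_le_integral => //.
  - by move=> w _; rewrite lee_fin normal_fun_ge0.
  - by apply/measurable_EFinP; exact: (measurableT_comp (measurable_normal_fun_mean s x)).
  - by move=> w _; rewrite lee_fin; have /andP[] := normal_fun_unit_interval (X w) s x.
rewrite ler0_norm ?ln_le0//.
apply: (@le_trans _ _ ((x ^+ 2 + q) / s ^+ 2)).
  rewrite lerNl -mulNr -[leLHS]expRK ler_ln// ?posrE ?expR_gt0//.
rewrite mulrAC ler_pM2r ?invr_gt0//; have := sqr_ge0 x; nra.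
Qed.

End smoothed_logarithm.

(** * Linear independent component analysis *)

Section linear_ica.
Context {d0 : measure_display} {T : measurableType d0} {R : realType}.
Context (P : probability T R) (n : nat) (Z : T -> n.-tuple R) (A : 'M[R]_n).
Hypotheses (mZ : measurable_fun setT Z) (indZ : mutually_independent P Z).
Hypothesis Z2 : forall j, finite_second_moment P (vcoord Z j).
Hypothesis ngZ : forall j, ~ is_gaussian P (vcoord Z j).
Hypothesis uA : A \in unitmx.
Let W w := mxv A (Z w).
Hypothesis indW : mutually_independent P W.

Let s j := fine (\int[P]_w (centered P (vcoord Z j) w * centered P (vcoord Z j) w)%:E)%E.
(** The variance of component [i] of A Z, the components of [Z] being uncorrelated. *)
Let s' i := \sum_j A i j * s j * A i j.

Let s_gt0 j : 0 < s j.
Proof. by apply: not_gaussian_variance_gt0 => //; exact: measurable_vcoord. Qed.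

Let s'_gt0 i : 0 < s' i.
Proof.
have ge0 j : 0 <= A i j * s j * A i j.
  by rewrite mulrAC -expr2 mulr_ge0 ?sqr_ge0// ltW.
rewrite lt_def sumr_ge0// andbT; apply/eqP => /eqP.
rewrite psumr_eq0// => /allP Ai0.
have : (A *m invmx A) i i = 1 by rewrite mulmxV// mxE eqxx.
rewrite mxE big1 => [/esym/eqP|j _]; first by rewrite oner_eq0.
have := Ai0 j (mem_index_enum j); rewrite !mulf_eq0 (gt_eqF (s_gt0 j)) orbF orbb.
by move=> /eqP ->; rewrite mul0r.
Qed.

(** Off the diagonal, the left side is the covariance of two components of [W], which are
    independent. *)
Let AsA i k : \sum_j A i j * s j * A k j = (i == k)%:R * s' i.
Proof.
case: eqVneq => [<-|ik]; first by rewrite mul1r.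
have := covariance_mxv mZ indZ Z2 A i k.
rewrite (mutually_independent_uncorrelated (measurable_mxv mZ A) indW)//.
  by move=> [<-]; rewrite mul0r.
by move=> j; exact: mxv_second_moment.
Qed.

(** The kernel is taken without its peak factor, so that it has values in the unit interval, as the
    product rule for independent components requires. *)
Let F t j y := fine (\int[P]_w (normal_fun (vcoord Z j w) (t * Num.sqrt (s j)) y)%:E)%E.
Let G t i y := fine (\int[P]_w (normal_fun (vcoord W i w) (t * Num.sqrt (s' i)) y)%:E)%E.

(* The Gaussian with covariance t^2 diag s is mapped by A to the one with
   covariance t^2 diag s', so that smoothing commutes with the mixing. *)
Let smoothed_mixture t (x : 'I_n -> R) : 0 < t ->
  \prod_j F t j (x j) = \prod_i G t i (\sum_j A i j * x j).
Proof.
move=> t0; apply: EFin_inj.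
rewrite -(mutually_independent_integral_prod mZ indZ
  (h := fun j z => normal_fun z (t * Num.sqrt (s j)) (x j))); last 2 first.
- by move=> j; exact: measurable_normal_fun_mean.
- by move=> j z; exact: normal_fun_unit_interval.
rewrite -(mutually_independent_integral_prod (measurable_mxv mZ A) indW
  (h := fun i z => normal_fun z (t * Num.sqrt (s' i)) (\sum_j A i j * x j))); last 2 first.
- by move=> j; exact: measurable_normal_fun_mean.
- by move=> j z; exact: normal_fun_unit_interval.
apply: eq_integral => w _; congr EFin.
rewrite /normal_fun -!expR_sum; congr expR.
have E (r u : R) : 0 < r ->
    - u ^+ 2 / ((t * Num.sqrt r) ^+ 2 *+ 2) = - (t ^+ 2 *+ 2)^-1 * (u ^+ 2 / r).
  move=> r0; rewrite exprMn sqr_sqrtr ?ltW//.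
  by rewrite -mulr_natr; field; rewrite !gt_eqF.
under eq_bigr do rewrite E//.
under [in RHS]eq_bigr do rewrite E// vcoord_mxv -sumrB.
rewrite -!mulr_sumr; congr (_ * _).
rewrite -(@weighted_quadratic_form _ _ A s s') //.
- apply: eq_bigr => i _; congr (_ ^+ 2 / _).
  by apply: eq_bigr => j _; rewrite mulrBr.
- by move=> j; rewrite gt_eqF.
- by move=> i; rewrite gt_eqF.
Qed.

Let F_gt0 t j y : 0 < t -> 0 < F t j y.
Proof.
move=> t0; apply: lt_le_trans (expR_gt0 _) (smoothed_ge_expR _ _ _ _) => //.
  by rewrite mulr_gt0// sqrtr_gt0.
exact: measurable_vcoord.
Qed.

Let G_gt0 t i y : 0 < t -> 0 < G t i y.
Proof.
move=> t0; apply: lt_le_trans (expR_gt0 _) (smoothed_ge_expR _ _ _ _) => //.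
- by rewrite mulr_gt0// sqrtr_gt0.
- exact: (measurable_vcoord (measurable_mxv mZ A)).
- exact: mxv_second_moment.
Qed.

Let ln_prod (H : 'I_n -> R) : (forall i, 0 < H i) ->
  ln (\prod_i H i) = \sum_i ln (H i).
Proof.
move=> H0; rewrite -[RHS]expRK expR_sum; congr ln.
by apply: eq_bigr => i _; rewrite lnK// posrE.
Qed.

Lemma mixing_column_support i k j : A i j != 0 -> A k j != 0 -> i = k.
Proof.
move=> Aij Akj; apply/eqP; apply: contrapT => /negP ik.
apply: (@ngZ j); apply: smoothed_quadratic_gaussian; first exact: measurable_vcoord.
(* With this scale, coordinate [j] is smoothed at exactly the prescribed width [sigma]. *)
move=> sigma sigma0; pose t := sigma / Num.sqrt (s j).
have rs : 0 < Num.sqrt (s j) by rewrite sqrtr_gt0.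
have t0 : 0 < t by rewrite divr_gt0.
have tE : t * Num.sqrt (s j) = sigma by rewrite divfK// gt_eqF.
have sep (x : 'I_n -> R) :
    \sum_l ln (F t l (x l)) = \sum_m ln (G t m (\sum_l A m l * x l)).
  transitivity (ln (\prod_l F t l (x l))).
    by apply/esym/ln_prod => l; exact: F_gt0.
  by rewrite (smoothed_mixture x t0); apply: ln_prod => i'; exact: G_gt0.
(* Entry (j, m) of the inverse is A m j times the nonzero factor s j / s' m. *)
have M0 m : A m j != 0 -> weighted_adjoint A s s' j m != 0.
  by move=> Amj; rewrite mxE !mulf_neq0// ?invr_eq0 gt_eqF.
have AM : A *m weighted_adjoint A s s' = 1%:M.
  by apply: mulmx_weighted_adjoint => // m; rewrite gt_eqF.
have [c fc] := separable_second_difference (f := fun l y => ln (F t l y))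
  (g := fun m y => ln (G t m y)) AM sep ik (M0 _ Aij) (M0 _ Akj).
have [K fK] : exists K, forall x, `|ln (F t j x)| <= K * (1 + x ^+ 2).
  rewrite /F tE; apply: ln_smoothed_bound => //; exact: measurable_vcoord.
have [p fp] := constant_second_difference_quadratic fc fK.
exists p => x; rewrite -fp lnK ?posrE ?F_gt0// /F tE fineK//.
by apply: smoothed_fin_num; exact: measurable_vcoord.
Qed.

Lemma linear_ica : exists Pm Lambda : 'M[R]_n,
  [/\ is_perm_mx Pm, is_diag_mx Lambda, Lambda \in unitmx & A = Pm *m Lambda].
Proof.
apply: (@single_support_monomial _ _ A s s') => //.
- by move=> j; rewrite gt_eqF.
- by move=> i; rewrite gt_eqF.
- exact: mixing_column_support.
Qed.

End linear_ica.

(** * Minimizers of the risk *)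

Section risk_minimizers.
Context {d0 : measure_display} {T : measurableType d0} {R : realType}.
Context (P : probability T R).

(** Here [f] stands for the unavoidable part of the loss and [g] for that of a minimizer. As the
    integral of [f] is finite it can be cancelled, and g - f >= 0 integrates to 0. *)
Lemma integral_le_ae_eq (f g : T -> R) :
  measurable_fun setT f -> measurable_fun setT g ->
  (forall w, 0 <= f w) -> (forall w, f w <= g w) ->
  (\int[P]_w (f w)%:E < +oo)%E ->
  (\int[P]_w (g w)%:E <= \int[P]_w (f w)%:E)%E ->
  {ae P, forall w, g w = f w}.
Proof.
move=> mf mg f0 fg foo gf.
have mB : measurable_fun setT (fun w => g w - f w) by exact: measurable_funB.
have d0' w : 0 <= g w - f w by rewrite subr_ge0.
have If0 : (0 <= \int[P]_w (f w)%:E)%E by apply: integral_ge0 => w _; rewrite lee_fin.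
have Ifin : (\int[P]_w (f w)%:E)%E \is a fin_num by rewrite ge0_fin_numE.
have : {ae P, forall w, g w - f w = 0}.
  apply: ge0_integral_eq0_ae => //.
  have Id0 : (0 <= \int[P]_w (g w - f w)%:E)%E.
    by apply: integral_ge0 => w _; rewrite lee_fin.
  apply/eqP; rewrite eq_le Id0 andbT.
  rewrite -(leeD2lE _ _ Ifin) adde0; apply: le_trans gf.
  rewrite -ge0_integralD//; try exact/measurable_EFinP;
    try by move=> w _; rewrite lee_fin.
  rewrite le_eqVlt; apply/orP; left; apply/eqP/eq_integral => w _.
  by rewrite -EFinD addrC subrK.
by apply: filterS => w /subr0_eq.
Qed.

Lemma sum_le_ae_eq (I : finType) (f g : I -> T -> R) :
  (forall i, measurable_fun setT (f i)) -> (forall i, measurable_fun setT (g i)) ->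
  (forall i w, 0 <= f i w) -> (forall i w, f i w <= g i w) ->
  (\int[P]_w (\sum_i f i w)%:E < +oo)%E ->
  (\int[P]_w (\sum_i g i w)%:E <= \int[P]_w (\sum_i f i w)%:E)%E ->
  {ae P, forall w, forall i, g i w = f i w}.
Proof.
move=> mf mg f0 fg foo gf.
have : {ae P, forall w, \sum_i g i w = \sum_i f i w}.
  apply: integral_le_ae_eq => //.
  - exact: measurable_sum.
  - exact: measurable_sum.
  - by move=> w; exact: sumr_ge0.
  - by move=> w; exact: ler_sum.
apply: filterS => w /eqP; rewrite eq_sym -subr_eq0 -sumrB.
rewrite -oppr_eq0 -sumrN psumr_eq0 => [/allP h i|i _]; last by rewrite opprB subr_ge0.
by have := h i (mem_index_enum i); rewrite opprB subr_eq0 => /eqP.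
Qed.

Lemma integral_sum_ge0 (I : finType) (f : I -> T -> R) :
  (forall i, measurable_fun setT (f i)) -> (forall i w, 0 <= f i w) ->
  (\int[P]_w (\sum_i f i w)%:E = \sum_i \int[P]_w (f i w)%:E)%E.
Proof.
move=> mf f0; under eq_integral do rewrite -sumEFin.
rewrite ge0_integral_sum//; first by move=> i; exact/measurable_EFinP.
by move=> i w _; rewrite lee_fin.
Qed.

Lemma second_moment_integral_lty (X : T -> R) : measurable_fun setT X ->
  (\int[P]_w (X w ^+ 2)%:E < +oo)%E -> finite_second_moment P X.
Proof.
move=> mX X2; apply/integrableP; split.
  by apply/measurable_EFinP; exact: measurable_funX.
rewrite (eq_integral (fun w => (X w ^+ 2)%:E))// => w _.
by rewrite /= ger0_norm// sqr_ge0.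
Qed.

Section cross_entropy.
Implicit Types a b : R.

(** The conditional mean, given Z, of the loss on one task, when the label has true logit [a] and
    the predicted logit is [b]. *)
Definition logit_cross_entropy a b : R :=
  - sigmoid a * ln (sigmoid b) - (1 - sigmoid a) * ln (1 - sigmoid b).

Lemma sigmoid_gt0 a : 0 < sigmoid a.
Proof. by rewrite invr_gt0 addr_gt0// expR_gt0. Qed.

Lemma sigmoid_lt1 a : sigmoid a < 1.
Proof. by rewrite invf_lt1 ?addr_gt0 ?expR_gt0// ltrDl expR_gt0. Qed.

Lemma sigmoid_inj : injective (@sigmoid R).
Proof.
by move=> a b /invr_inj/addrI/expR_inj/oppr_inj.
Qed.

(* Gibbs' inequality, from [ln x < x - 1] for [x != 1]. *)
Lemma logit_cross_entropy_gibbs a b :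
  logit_cross_entropy a a <= logit_cross_entropy a b ?= iff (a == b).
Proof.
have ln_lt (x : R) : 0 < x -> x != 1 -> ln x < x - 1.
  move=> x0 x1; rewrite -ltr_expR lnK// -[ltLHS](subrK 1) addrC.
  by apply: expR_gt1Dx; rewrite subr_eq0.
have ln_le (x : R) : 0 < x -> ln x <= x - 1.
  by move=> x0; have [->|x1] := eqVneq x 1; [rewrite ln1 subrr|exact/ltW/ln_lt].
set p := sigmoid a; set q := sigmoid b.
have p0 : 0 < p := sigmoid_gt0 a; have p1 : 0 < 1 - p by rewrite subr_gt0 sigmoid_lt1.
have q0 : 0 < q := sigmoid_gt0 b; have q1 : 0 < 1 - q by rewrite subr_gt0 sigmoid_lt1.
have dE : logit_cross_entropy a b - logit_cross_entropy a a =
    - (p * ln (q / p) + (1 - p) * ln ((1 - q) / (1 - p))).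
  by rewrite /logit_cross_entropy -/p -/q !ln_div ?posrE//; ring.
have sum0 : p * (q / p - 1) + (1 - p) * ((1 - q) / (1 - p) - 1) = 0.
  by field; rewrite !gt_eqF.
apply/leifP; have [->|ab] := eqVneq a b; first by [].
rewrite -subr_gt0 dE oppr_gt0 -sum0; apply: ltr_leD.
  rewrite ltr_pM2l//; apply: ln_lt; first exact: divr_gt0.
  apply: contra ab => /eqP/divr1_eq e; apply/eqP/sigmoid_inj.
  by rewrite -/p -/q e.
by rewrite ler_pM2l// ln_le// divr_gt0.
Qed.

Lemma logit_cross_entropy_ge0 a b : 0 <= logit_cross_entropy a b.
Proof.
have ln0 (c : R) : ln (sigmoid c) <= 0 by exact: ln_le0 (ltW (sigmoid_lt1 c)).
have ln1 (c : R) : ln (1 - sigmoid c) <= 0.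
  by apply: ln_le0; rewrite gerBl; exact: ltW (sigmoid_gt0 _).
rewrite /logit_cross_entropy mulNr -opprD oppr_ge0 -[leRHS](addr0 0) lerD//.
  by apply: mulr_ge0_le0 => //; exact: ltW (sigmoid_gt0 _).
by apply: mulr_ge0_le0 => //; rewrite subr_ge0; exact: ltW (sigmoid_lt1 _).
Qed.

(* [- p ln p <= 1 - p], from [ln (1 / p) <= 1 / p - 1]. *)
Lemma logit_entropy_le1 a : logit_cross_entropy a a <= 1.
Proof.
have ent (x : R) : 0 < x -> - x * ln x <= 1 - x.
  move=> x0; have : ln x^-1 <= x^-1 - 1.
    have := @le_ln1Dx R (x^-1 - 1); have -> : 1 + (x^-1 - 1) = x^-1 by ring.
    apply.
    by rewrite ltrBrDl subrr invr_gt0.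
  rewrite lnV ?posrE// -(ler_pM2l x0) mulrBr divff ?gt_eqF// mulr1.
  by rewrite mulrN mulNr.
have := ent _ (sigmoid_gt0 a).
have := ent (1 - sigmoid a); rewrite subr_gt0 sigmoid_lt1 => /(_ isT).
by rewrite /logit_cross_entropy !mulNr; lra.
Qed.

End cross_entropy.

End risk_minimizers.
Section erm_identifies_scores.
Context {d0 : measure_display} {T : measurableType d0} {R : realType}.
Context (P : probability T R) (n : nat) (Z Y : T -> n.-tuple R) (Gamma : 'M[R]_n).
Hypotheses (mZ : measurable_fun setT Z) (mY : measurable_fun setT Y).
Implicit Types u : n.-tuple R -> n.-tuple R.

Lemma measurable_mxv_tuple (A : 'M[R]_n) : measurable_fun setT (mxv A).
Proof. exact: (measurable_mxv (@measurable_id _ _ _)). Qed.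

(* E |Y - u(Z)|^2 = E |N|^2 + E |Gamma Z - u(Z)|^2: the cross terms vanish
   because the noise is centered and independent of Z. *)
Lemma regression_scores u : measurable_fun setT u ->
  label_model P Regression Gamma Z Y ->
  (\int[P]_w (square_loss (Y w) (u (Z w)))%:E <=
   \int[P]_w (square_loss (Y w) (mxv Gamma (Z w)))%:E)%E ->
  {ae P, forall w, u (Z w) = mxv Gamma (Z w)}.
Proof.
move=> mu [N [mN [indN [N2 [EN YE]]]]] risk.
pose D i w := tnth (mxv Gamma (Z w)) i - tnth (u (Z w)) i.
pose h i z := tnth (mxv Gamma z) i - tnth (u z) i.
have mh i : measurable_fun setT (h i).
  apply: measurable_funB; apply: measurableT_comp (measurable_tnth i) _ => //.
  exact: measurable_mxv_tuple.
have mD i : measurable_fun setT (D i) by exact: (measurableT_comp (mh i) mZ).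
have mNi i : measurable_fun setT (vcoord N i) by exact: measurable_vcoord.
have lossE w : square_loss (Y w) (u (Z w)) = \sum_i (vcoord N i w + D i w) ^+ 2.
  by apply: eq_bigr => i _; rewrite YE /D /vcoord; congr (_ ^+ 2); ring.
have loss0 w : square_loss (Y w) (mxv Gamma (Z w)) = \sum_i vcoord N i w ^+ 2.
  by apply: eq_bigr => i _; rewrite YE /vcoord; congr (_ ^+ 2); ring.
have N2fin : (\int[P]_w (\sum_i vcoord N i w ^+ 2)%:E < +oo)%E.
  by rewrite integral_sum_fin ?ltry// => i; exact: N2.
move: risk; under eq_integral do rewrite lossE.
under [X in (_ <= X)%E]eq_integral do rewrite loss0.
move=> risk.
have mS i : measurable_fun setT (fun w => (vcoord N i w + D i w) ^+ 2).
  by apply: measurable_funX; exact: measurable_funD.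
(* The risk is at most E |N|^2, which makes N + D square integrable; D = (N + D) - N then is so too,
   and the cross term below has a meaning. *)
have S2 i : finite_second_moment P (fun w => vcoord N i w + D i w).
  apply: second_moment_integral_lty; first exact: measurable_funD.
  apply: le_lt_trans (le_lt_trans risk N2fin).
  apply: ge0_le_integral => //.
  - by move=> w _; rewrite lee_fin sqr_ge0.
  - exact/measurable_EFinP.
  - by apply/measurable_EFinP; exact: measurable_sum.
  - move=> w _; rewrite lee_fin (bigD1 i)//= lerDl.
    by apply: sumr_ge0 => k _; exact: sqr_ge0.
have D2 i : finite_second_moment P (D i).
  apply: (@integrable_dominated _ _ _ P _
    (fun w => 2 * (vcoord N i w + D i w) ^+ 2 + 2 * vcoord N i w ^+ 2)).
  - exact: measurable_funX.
  - move=> w; rewrite ger0_norm ?sqr_ge0//.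
    by have := sqr_ge0 (2 * vcoord N i w + D i w); rewrite !expr2; nra.
  - under [X in integrable _ _ X]eq_fun do rewrite EFinD.
    apply: integrableD => //; apply: integrable_scale; [exact: S2|exact: N2].
have cross i : (\int[P]_w (vcoord N i w * D i w)%:E = 0)%E.
  apply: (@integral_indep_mean0 _ _ _ P _ _ (vcoord N i) Z (h i) (mNi i) mZ (mh i) _
    (N2 i) (D2 i) (EN i)) => C B mC mB.
  rewrite setIC muleC; have := indN B ((fun y => tnth y i) @^-1` C) mB; apply.
  by rewrite -[_ @^-1` _]setTI; exact: (measurable_tnth i).
have : {ae P, forall w, forall i, vcoord N i w ^+ 2 + D i w ^+ 2 = vcoord N i w ^+ 2}.
  apply: sum_le_ae_eq => //.
  - by move=> i; exact: measurable_funX.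
  - by move=> i; apply: measurable_funD; exact: measurable_funX.
  - by move=> i w; exact: sqr_ge0.
  - by move=> i w; rewrite lerDl sqr_ge0.
  - apply: le_trans risk; rewrite le_eqVlt; apply/orP; left; apply/eqP.
    have iND i := second_moment_mul_integrable (mNi i) (mD i) (N2 i) (D2 i).
    have iS i : P.-integrable setT (fun w => (vcoord N i w ^+ 2 + D i w ^+ 2)%:E).
      under [X in integrable _ _ X]eq_fun do rewrite EFinD.
      by apply: integrableD => //; [exact: N2|exact: D2].
    rewrite !integral_sum_fin//; congr EFin; apply: eq_bigr => i _; congr fine.
    transitivity (\int[P]_w ((vcoord N i w ^+ 2 + D i w ^+ 2)%:E +
        (2 * (vcoord N i w * D i w))%:E))%E; last first.
      by apply: eq_integral => w _; rewrite -EFinD; congr EFin; ring.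
    rewrite integralD//; last exact: integrable_scale.
    under [X in (_ = _ + X)%E]eq_integral do rewrite EFinM.
    by rewrite integralZl// cross mule0 adde0.
apply: filterS => w Dw; apply/eq_from_tnth => i; apply/eqP.
have := Dw i; rewrite -[RHS]addr0 => /addrI/eqP.
by rewrite sqrf_eq0 subr_eq0 eq_sym.
Qed.

Lemma measurable_sigmoid : measurable_fun setT (@sigmoid R).
Proof.
apply: continuous_measurable_fun => x; apply: cvgV.
  by rewrite gt_eqF// addr_gt0// expR_gt0.
apply: cvgD; first exact: cvg_cst.
apply: (cvg_comp -%R expR); last exact: continuous_expR.
exact: cvgN.
Qed.

(** On an event of [Z], the integral of a 0-1 label is the probability given by the label model.
    Label and sigmoid are thus weights that the transfer lemma exchanges; so are their complements
    to 1. *)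
Lemma classification_label_integral (h : n.-tuple R -> R) i :
  label_model P Classification Gamma Z Y ->
  measurable_fun setT h -> (forall z, 0 <= h z) ->
  (\int[P]_w (tnth (Y w) i * h (Z w))%:E =
   \int[P]_w (sigmoid (tnth (mxv Gamma (Z w)) i) * h (Z w))%:E)%E /\
  (\int[P]_w ((1 - tnth (Y w) i) * h (Z w))%:E =
   \int[P]_w ((1 - sigmoid (tnth (mxv Gamma (Z w)) i)) * h (Z w))%:E)%E.
Proof.
move=> [Y01 Yp] mh h0.
have mYi : measurable_fun setT (fun w => tnth (Y w) i) by exact: (measurable_vcoord mY).
have mp : measurable_fun setT (fun w => sigmoid (tnth (mxv Gamma (Z w)) i)).
  apply: (measurableT_comp measurable_sigmoid).
  exact: (measurable_vcoord (measurable_mxv mZ Gamma)).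
have Y0 w : 0 <= tnth (Y w) i by case: (Y01 w i) => ->.
have Y1 w : 0 <= 1 - tnth (Y w) i by case: (Y01 w i) => ->; lra.
have p0 w : 0 <= sigmoid (tnth (mxv Gamma (Z w)) i) by exact: ltW (sigmoid_gt0 _).
have p1 w : 0 <= 1 - sigmoid (tnth (mxv Gamma (Z w)) i).
  by rewrite subr_ge0; exact: ltW (sigmoid_lt1 _).
have mZB B : measurable B -> measurable (Z @^-1` B).
  by move=> mB; rewrite -[_ @^-1` _]setTI; exact: mZ.
have YB B : measurable B -> (\int[P]_(w in Z @^-1` B) (tnth (Y w) i)%:E =
    \int[P]_(w in Z @^-1` B) (sigmoid (tnth (mxv Gamma (Z w)) i))%:E)%E.
  move=> mB; rewrite -Yp//.
  have mY1 : measurable [set w | tnth (Y w) i = 1].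
    have := @measurable_vcoord_preimage _ _ _ n Y mY i [set 1] (measurable_set1 1).
    by apply.
  transitivity (\int[P]_(w in Z @^-1` B) (\1_[set w | tnth (Y w) i = 1] w)%:E)%E; last first.
    by rewrite integral_indic//; exact: mZB.
  apply: eq_integral => w _; rewrite indicE; congr EFin.
  case: (Y01 w i) => e.
    by rewrite e memNset//= e => /esym/eqP; rewrite oner_eq0.
  by rewrite e mem_set.
split; apply: integral_weight_transfer => //.
- exact: measurable_funB.
- exact: measurable_funB.
move=> B mB.
have one (f : T -> R) : measurable_fun setT f -> (forall w, 0 <= f w <= 1) ->
    (\int[P]_(w in Z @^-1` B) (1 - f w)%:E = P (Z @^-1` B) - \int[P]_(w in Z @^-1` B) (f w)%:E)%E.
  move=> mf f01; under eq_integral do rewrite EFinB.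
  have if1 : P.-integrable (Z @^-1` B) (fun w => (f w)%:E).
    apply: (@integrableS _ _ _ P setT) => //; first exact: mZB.
    apply: (@integrable_dominated _ _ _ P f (fun=> 1)) => //.
      by move=> w; have /andP[? ?] := f01 w; rewrite ger0_norm.
    exact: finite_measure_integrable_cst.
  have i1 : P.-integrable (Z @^-1` B) (fun=> 1%:E).
    apply: (@integrableS _ _ _ P setT) => //; first exact: mZB.
    exact: finite_measure_integrable_cst.
  rewrite (integralB (mZB _ mB) i1 if1); congr (_ - _)%E.
  transitivity (1%:E * P (Z @^-1` B))%E; last by rewrite mul1e.
  by apply: integral_cst; exact: mZB.
rewrite !one// ?YB// => w; apply/andP; split => //.
- exact: ltW (sigmoid_lt1 _).
- by have := Y1 w; rewrite subr_ge0.
Qed.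

(** The loss is affine in each label, so averaging given Z replaces a label by its success
    probability. All terms are nonnegative, so the splitting is legitimate even if the risk is
    infinite. *)
Lemma classification_risk u : measurable_fun setT u ->
  label_model P Classification Gamma Z Y ->
  (\int[P]_w (cross_entropy_loss (Y w) (u (Z w)))%:E =
   \int[P]_w (\sum_i logit_cross_entropy (tnth (mxv Gamma (Z w)) i) (tnth (u (Z w)) i))%:E)%E.
Proof.
move=> mu lab; have [Y01 _] := lab.
pose h1 i z := - ln (sigmoid (tnth (u z) i)).
pose h2 i z := - ln (1 - sigmoid (tnth (u z) i)).
have mui i : measurable_fun setT (fun z => sigmoid (tnth (u z) i)).
  by apply: (measurableT_comp measurable_sigmoid); exact: (measurableT_comp (measurable_tnth i) mu).
have mh1 i : measurable_fun setT (h1 i).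
  by apply: measurable_funN; exact: (measurableT_comp (@measurable_ln R)).
have mh2 i : measurable_fun setT (h2 i).
  apply: measurable_funN; apply: (measurableT_comp (@measurable_ln R)).
  exact: measurable_funB.
have h10 i z : 0 <= h1 i z.
  by rewrite oppr_ge0; apply: ln_le0; exact: ltW (sigmoid_lt1 _).
have h20 i z : 0 <= h2 i z.
  by rewrite oppr_ge0; apply: ln_le0; rewrite gerBl; exact: ltW (sigmoid_gt0 _).
have mYi i : measurable_fun setT (fun w => tnth (Y w) i) by exact: (measurable_vcoord mY).
have mp i : measurable_fun setT (fun w => sigmoid (tnth (mxv Gamma (Z w)) i)).
  apply: (measurableT_comp measurable_sigmoid).
  exact: (measurable_vcoord (measurable_mxv mZ Gamma)).
have mix (y : 'I_n -> T -> R) : (forall i, measurable_fun setT (y i)) ->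
    (forall i w, 0 <= y i w <= 1) ->
    (\int[P]_w (\sum_i (y i w * h1 i (Z w) + (1 - y i w) * h2 i (Z w)))%:E =
     \sum_i (\int[P]_w (y i w * h1 i (Z w))%:E + \int[P]_w ((1 - y i w) * h2 i (Z w))%:E))%E.
  move=> my y01.
  have m1 i : measurable_fun setT (fun w => y i w * h1 i (Z w)).
    by apply: measurable_funM => //; exact: (measurableT_comp (mh1 i) mZ).
  have m2 i : measurable_fun setT (fun w => (1 - y i w) * h2 i (Z w)).
    by apply: measurable_funM; [exact: measurable_funB|exact: (measurableT_comp (mh2 i) mZ)].
  have y1 i w : 0 <= y i w * h1 i (Z w).
    by have /andP[? _] := y01 i w; exact: mulr_ge0.
  have y2 i w : 0 <= (1 - y i w) * h2 i (Z w).
    by have /andP[_ ?] := y01 i w; apply: mulr_ge0 => //; rewrite subr_ge0.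
  rewrite integral_sum_ge0 => [|i|i w]; last 2 first.
  - exact: measurable_funD.
  - exact: addr_ge0.
  apply: eq_bigr => i _; under eq_integral do rewrite EFinD.
  rewrite ge0_integralD//; try exact/measurable_EFinP;
    by move=> w _; rewrite lee_fin.
transitivity (\int[P]_w (\sum_i (tnth (Y w) i * h1 i (Z w) +
    (1 - tnth (Y w) i) * h2 i (Z w)))%:E)%E.
  apply: eq_integral => w _; congr EFin; apply: eq_bigr => i _.
  by rewrite /h1 /h2; ring.
rewrite (mix (fun i w => tnth (Y w) i))//; last first.
  by move=> i w; case: (Y01 w i) => ->; rewrite lexx ler01.
transitivity (\int[P]_w (\sum_i (sigmoid (tnth (mxv Gamma (Z w)) i) * h1 i (Z w) +
    (1 - sigmoid (tnth (mxv Gamma (Z w)) i)) * h2 i (Z w)))%:E)%E; last first.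
  apply: eq_integral => w _; congr EFin; apply: eq_bigr => i _.
  by rewrite /h1 /h2 /logit_cross_entropy; ring.
rewrite (mix (fun i w => sigmoid (tnth (mxv Gamma (Z w)) i)))//; last first.
  by move=> i w; rewrite (ltW (sigmoid_gt0 _)) (ltW (sigmoid_lt1 _)).
apply: eq_bigr => i _; congr (_ + _)%E.
- by have [-> _] := classification_label_integral i lab (mh1 i) (h10 i).
- by have [_ ->] := classification_label_integral i lab (mh2 i) (h20 i).
Qed.

Lemma measurable_logit_cross_entropy (a b : T -> R) :
  measurable_fun setT a -> measurable_fun setT b ->
  measurable_fun setT (fun w => logit_cross_entropy (a w) (b w)).
Proof.
move=> ma mb.
have msa := measurableT_comp measurable_sigmoid ma.
have msb := measurableT_comp measurable_sigmoid mb.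
apply: measurable_funB; apply: measurable_funM.
- exact: measurable_funN.
- exact: (measurableT_comp (@measurable_ln R)).
- exact: measurable_funB.
- by apply: (measurableT_comp (@measurable_ln R)); exact: measurable_funB.
Qed.

(** The least risk is at most [n], each binary entropy being at most 1, so it can be cancelled; the
    equality case of Gibbs' inequality then gives equal logits. *)
Lemma classification_scores u : measurable_fun setT u ->
  label_model P Classification Gamma Z Y ->
  (\int[P]_w (cross_entropy_loss (Y w) (u (Z w)))%:E <=
   \int[P]_w (cross_entropy_loss (Y w) (mxv Gamma (Z w)))%:E)%E ->
  {ae P, forall w, u (Z w) = mxv Gamma (Z w)}.
Proof.
move=> mu lab; rewrite !classification_risk//; last exact: measurable_mxv_tuple.
move=> risk.
pose a i w := tnth (mxv Gamma (Z w)) i; pose b i w := tnth (u (Z w)) i.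
have ma i : measurable_fun setT (a i).
  exact: (measurable_vcoord (measurable_mxv mZ Gamma)).
have mb i : measurable_fun setT (b i).
  exact: (measurableT_comp (measurable_tnth i) (measurableT_comp mu mZ)).
have : {ae P, forall w, forall i,
    logit_cross_entropy (a i w) (b i w) = logit_cross_entropy (a i w) (a i w)}.
  apply: sum_le_ae_eq => //.
  - by move=> i; exact: measurable_logit_cross_entropy.
  - by move=> i; exact: measurable_logit_cross_entropy.
  - by move=> i w; exact: logit_cross_entropy_ge0.
  - by move=> i w; exact: (logit_cross_entropy_gibbs _ _).1.
  - apply: (@le_lt_trans _ _ (\int[P]_w (\sum_(i < n) (1 : R))%:E)%E); last first.
      by rewrite integral_probability_cst ltry.
    apply: ge0_le_integral => //.
    + by move=> w _; rewrite lee_fin sumr_ge0// => i _; exact: logit_cross_entropy_ge0.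
    + apply/measurable_EFinP; apply: measurable_sum => i.
      exact: measurable_logit_cross_entropy.
    + by move=> w _; rewrite lee_fin ler_sum// => i _; exact: logit_entropy_le1.
apply: filterS => w Dw; apply/eq_from_tnth => i; apply/eqP.
by have := (logit_cross_entropy_gibbs (a i w) (b i w)).2; rewrite Dw eqxx eq_sym => /esym.
Qed.

End erm_identifies_scores.

(** * Conclusion: from optimal scores to the mixing matrix *)

Section matrix_action.
Context {R : realType} (n : nat).
Implicit Types (A B : 'M[R]_n) (v : n.-tuple R).

Lemma mxvM A B v : mxv (A *m B) v = mxv A (mxv B v).
Proof.
apply/eq_from_tnth => i; rewrite !tnth_mktuple.
under [RHS]eq_bigr do rewrite tnth_mktuple mulr_sumr.
rewrite exchange_big/=; apply: eq_bigr => j _.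
by rewrite mxE mulr_suml; apply: eq_bigr => k _; rewrite mulrA.
Qed.

Lemma mxv1 v : mxv 1%:M v = v.
Proof.
apply/eq_from_tnth => i; rewrite tnth_mktuple (bigD1 i)//= mxE eqxx mul1r.
rewrite big1 ?addr0// => j ji.
by rewrite mxE eq_sym (negbTE ji) mul0r.
Qed.

End matrix_action.

(** Phi(X) = A Z holds only almost surely. A joint event is the preimage of one measurable box of
    tuples, so its probability is unaffected, and likewise for each marginal. *)
Lemma mutually_independent_ae_eq {d0 : measure_display} {T : measurableType d0}
    {R : realType} (P : probability T R) (n : nat) (U V : T -> n.-tuple R) :
  measurable_fun setT U -> measurable_fun setT V ->
  {ae P, forall w, U w = V w} ->
  mutually_independent P U -> mutually_independent P V.
Proof.
move=> mU mV UV indU M B mB.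
have mBi i : measurable ((fun y : n.-tuple R => tnth y i) @^-1` B i).
  by rewrite -[_ @^-1` _]setTI; exact: (measurable_tnth i).
have mE : measurable (\bigcap_(i in [set i | i \in M])
    ((fun y : n.-tuple R => tnth y i) @^-1` B i)).
  by apply: fin_bigcap_measurable => //; exact: finite_finset.
have := indU M B mB.
have := ae_eq_preimage mU mV mE UV; rewrite !preimage_bigcap => -> ->.
by apply: eq_bigr => i _; exact: (ae_eq_preimage mU mV (mBi i) UV).
Qed.

Theorem theorem1 (R : realType) (d0 : measure_display) (T : measurableType d0)
  (P : probability T R) (d : nat) (t : task)
  (Z Y : T -> d.-tuple R) (g ginv : d.-tuple R -> d.-tuple R)
  (Gamma : 'M[R]_d) (H_Phi : set (d.-tuple R -> d.-tuple R))
  (Theta_dag : 'M[R]_d) (Phi_dag : d.-tuple R -> d.-tuple R) :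
  (0 < d)%N ->
  (* latent variables Z *)
  measurable_fun setT Z ->
  mutually_independent P Z ->
  (forall i, ~ is_gaussian P (vcoord Z i)) ->
  (forall i, finite_second_moment P (vcoord Z i)) ->
  (* X = g(Z), g a (measurable) bijection with inverse ginv *)
  measurable_fun setT g ->
  cancel g ginv -> cancel ginv g ->
  (* labels *)
  measurable_fun setT Y ->
  label_model P t Gamma Z Y ->
  (* hypothesis classes: H_Phi consists of measurable maps and contains g^-1;
     H_Theta = invertible d x d matrices, containing Gamma *)
  (forall Phi, H_Phi Phi -> measurable_fun setT Phi) ->
  H_Phi ginv ->
  Gamma \in unitmx ->
  (* (Theta_dag, Phi_dag) solves the independence-constrained ERM problem *)
  Theta_dag \in unitmx -> H_Phi Phi_dag ->
  mutually_independent P (fun w => Phi_dag (g (Z w))) ->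
  (forall (Theta : 'M[R]_d) (Phi : d.-tuple R -> d.-tuple R),
     Theta \in unitmx -> H_Phi Phi ->
     mutually_independent P (fun w => Phi (g (Z w))) ->
     (risk P t (fun w => g (Z w)) Y Theta_dag Phi_dag
        <= risk P t (fun w => g (Z w)) Y Theta Phi)%E) ->
  (* identification up to permutation and scaling *)
  exists (Pm Lambda : 'M[R]_d),
    is_perm_mx Pm /\ is_diag_mx Lambda /\ Lambda \in unitmx /\
    {ae P, forall w, Phi_dag (g (Z w)) = mxv (Pm *m Lambda) (Z w)}.
Proof.
move=> _ mZ indZ ngZ Z2 mg gK _ mY lab mPhi Hginv uG uT HPhi indPhi opt.
(* The matrix left after cancelling [Theta_dag] in the almost sure identity Theta Phi(X) = Gamma
   Z. *)
pose A := invmx Theta_dag *m Gamma.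
pose u z := mxv Theta_dag (Phi_dag (g z)).
have mPg : measurable_fun setT (Phi_dag \o g) by apply: measurableT_comp => //; exact: mPhi.
have mu : measurable_fun setT u by exact: (measurableT_comp (measurable_mxv_tuple _) mPg).
have risk_le : (risk P t (fun w => g (Z w)) Y Theta_dag Phi_dag <=
    \int[P]_w (loss t (Y w) (mxv Gamma (Z w)))%:E)%E.
  apply: le_trans (opt Gamma ginv uG Hginv _) _.
    by rewrite (_ : (fun w => _) = Z)//; apply/funext => w; rewrite gK.
  by rewrite /risk; under eq_integral do rewrite gK.
have scores : {ae P, forall w, u (Z w) = mxv Gamma (Z w)}.
  case: t lab risk_le {opt} => lab risk_le.
  - exact: (regression_scores mZ mu lab risk_le).
  - exact: (classification_scores mZ mY mu lab risk_le).
have PhiA : {ae P, forall w, Phi_dag (g (Z w)) = mxv A (Z w)}.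
  apply: filterS scores => w uw.
  by rewrite /A mxvM -uw /u -mxvM mulVmx// mxv1.
have uA : A \in unitmx by rewrite unitmx_mul unitmx_inv uT.
have indA : mutually_independent P (fun w => mxv A (Z w)).
  apply: mutually_independent_ae_eq PhiA indPhi.
  - exact: (measurableT_comp mPg mZ).
  - exact: measurable_mxv.
have [Pm [Lambda [permP diagL unitL AE]]] := linear_ica mZ indZ Z2 ngZ uA indA.
exists Pm, Lambda; do 3 split => //.
by rewrite -AE.
Qed.
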